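(* Assume the following. (1) There exist non-random $D_n>\sqrt2$ and non-random $\overline\theta_S\in\mathbb R^{|S|}$ with $\mathbf F_{n,\overline\theta_S}$ nonsingular such that, with $\mathbb P_0^{(n)}$-probability at least $1-p^{-1}$, for all $S\in\mathscr S_{s_{\max}}$, $D_n^{-1}\mathbf I_{|S|}\preceq \mathbf F_{n,\hat\theta_S}\mathbf F_{n,\overline\theta_S}^{-1}\preceq D_n\mathbf I_{|S|}$ and $\|\mathbf F_{n,\overline\theta_S}^{1/2}(\hat\theta_S-\overline\theta_S)\|_2^2\le D_n|S|\log p$. Moreover $\mathbf F_{n,\theta^*_{S_0}}$ is nonsingular and $\zeta_{n,S_0}^2s_0\log p=o(1)$. (2) $\log\big([\max_{i}b''(x_i^\top\theta_0)]\vee\|\mathbf X_{S_0}\|_\infty\vee\rho_{\min,S_0}^{-1}\vee\rho_{\max,S_0}\big)=O(\log p)$ and $s_0\log p=o(n)$; there are constants $A_5,A_6>0$, $A_7\ge0$ with $p^{-A_5}\le\lambda\le A_6p^{-A_7}$; $\alpha\in(0,1)$; $A_6p^{-A_7}<A_4$; and $\log_p(D_n)=o(1)$. Then there exists a constant $K_{\rm dim}>1$ such that, for all sufficiently large $n$, $$\mathbb E\,\Pi_\alpha^n\{\theta:|S_\theta|>K_{\rm dim}s_0\}\le (s_0\log p)^{-1}+2p^{-1}+p^{-s_0}.$$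
   Context: Asymptotics are as $n\to\infty$; $p,\mathbf X,\theta_0,s_{\max},w_n,\lambda,D_n$ may depend on $n$, quantities called constants do not. $p\ge n^{c}$ for some constant $c>0$. The covariates $x_1,\dots,x_n\in\mathbb R^p$ are non-random; $\mathbf X=(x_{ij})\in\mathbb R^{n\times p}$ has rows $x_i^\top$. Model: $p_\theta(y\mid x)=\exp\{y\,x^\top\theta-b(x^\top\theta)+k(y)\}$ with $b,k$ known, $b$ strictly convex and three times differentiable; $C_{\rm dev}\ge1$ is a constant depending only on $b$ with $\sup_{|y|\le1/2}b''(x+y)\le C_{\rm dev}b''(x)$ for all $x\in\mathbb R$. $Y_1,\dots,Y_n$ are independent, $Y_i$ with density/mass function $p_{\theta_0}(\cdot\mid x_i)$ for a true $\theta_0\in\mathbb R^p\setminus\{0\}$; $\mathbb P_0^{(n)},\mathbb E$ are the corresponding probability and expectation. $S_\theta=\{j:\theta_j\ne0\}$, $S_0=S_{\theta_0}$, $s_0=|S_0|$, $[p]=\{1,\dots,p\}$, $\mathscr S_s=\{S\subset[p]:|S|\le s\}$. For $S\subseteq[p]$: $x_{i,S}=(x_{ij})_{j\in S}$, $\mathbf X_S$ is the submatrix of columns in $S$; for $\theta_S\in\mathbb R^{|S|}$, $L_{n,\theta_S}=\sum_i\{Y_ix_{i,S}^\top\theta_S-b(x_{i,S}^\top\theta_S)+k(Y_i)\}$ ($L_{n,\theta}$ is the case $S=[p]$); $\hat\theta_S=\arg\max L_{n,\theta_S}$ (MLE), $\theta_S^*=\arg\max\mathbb E L_{n,\theta_S}$;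 $\mathbf F_{n,\theta_S}=\sum_ib''(x_{i,S}^\top\theta_S)x_{i,S}x_{i,S}^\top$; $\zeta_{n,S}=\max_i\|\mathbf F_{n,\theta_S^*}^{-1/2}x_{i,S}\|_2$; $\rho_{\min,S},\rho_{\max,S}$ are the smallest and largest eigenvalues of $\mathbf F_{n,\theta_S^*}$. $\|\mathbf A\|_\infty=\max_i\sum_j|a_{ij}|$. The relation $D_n^{-1}\mathbf I\preceq\mathbf F\mathbf G^{-1}\preceq D_n\mathbf I$ is read as $D_n^{-1}\mathbf G\preceq\mathbf F\preceq D_n\mathbf G$ in the positive semidefinite order. Prior: $s_{\max}$ is an integer with $s_0\le s_{\max}\le\operatorname{rank}(\mathbf X)$; $w_n$ is a probability mass function on $\{0,\dots,s_{\max}\}$ and $A_1,\dots,A_4>0$ are constants with $A_1p^{-A_3}w_n(s-1)\le w_n(s)\le A_2p^{-A_4}w_n(s-1)$ for $1\le s\le s_{\max}$; $\pi_n(S)=w_n(|S|)\binom{p}{|S|}^{-1}$; for $\lambda>0$, $g_S$ is the density of $\mathcal N(\hat\theta_S,\{\lambda\mathbf F_{n,\hat\theta_S}\}^{-1})$ on $\mathbb R^{|S|}$. The (data-dependent) prior is $\Pi_n(d\theta)=\sum_S\pi_n(S)g_S(\theta_S)\,d\theta_S\times\delta_0(d\theta_{S^c})$ and the $\alpha$-fractional posterior is $\Pi_\alpha^n(\mathcal A)=\int_{\mathcal A}e^{\alpha L_{n,\theta}}\Pi_n(d\theta)\big/\int e^{\alpha L_{n,\theta}}\Pi_n(d\theta)$.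 *)

(* Defs.v *)
From mathcomp Require Export all_boot all_order all_algebra.
From mathcomp Require Export all_classical all_reals all_analysis.
Export Order.TTheory GRing.Theory Num.Theory.
Export numFieldNormedType.Exports.

Set Implicit Arguments.
Unset Strict Implicit.
Unset Printing Implicit Defensive.

Local Open Scope classical_set_scope.
Local Open Scope ring_scope.

Section Matrices.
Context {R : realType}.

(* The library norm on matrices is the entrywise sup norm. *)
Definition l2norm m (v : 'cV[R]_m) : R := Num.sqrt (\sum_i v i 0 ^+ 2).

Definition row_sum_norm m n (A : 'M[R]_(m, n)) : R :=
  \big[Num.max/0]_i \sum_j `|A i j|.

Definition qform m (A : 'M[R]_m) (v : 'cV[R]_m) : R := (v^T *m A *m v) 0 0.

Definition psdmx m (A : 'M[R]_m) : Prop :=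
  A^T = A /\ forall v : 'cV[R]_m, 0 <= qform A v.

Definition loewner_le m (A B : 'M[R]_m) : Prop := psdmx (B - A).

(* A positive semidefinite matrix has exactly one positive semidefinite square
   root; the value is 0 when A is not positive semidefinite. *)
Definition sqrtmx m (A : 'M[R]_m) : 'M[R]_m :=
  xget 0 [set B | psdmx B /\ B *m B = A].

(* For a symmetric matrix of positive size the spectrum is finite and nonempty,
   so these are the smallest and the largest eigenvalue. *)
Definition min_eigenvalue m (A : 'M[R]_m) : R := inf [set a | eigenvalue A a].
Definition max_eigenvalue m (A : 'M[R]_m) : R := sup [set a | eigenvalue A a].

Definition supp p (theta : 'cV[R]_p) : {set 'I_p} :=
  [set j | theta j 0 != 0].

(* The coordinates of S are listed in the order of [enum S]. *)
Definition cols n p (X : 'M[R]_(n, p)) (S : {set 'I_p}) : 'M[R]_(n, #|S|) :=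
  colsub (fun l : 'I_#|S| => enum_val l) X.

(* The vector of R^p with S-coordinates t and zeros outside S, i.e. the
   push-forward of d(theta_S) under this map is d(theta_S) x delta_0. *)
Definition extend p (S : {set 'I_p}) (t : 'cV[R]_#|S|) : 'cV[R]_p :=
  \col_j \sum_(l < #|S| | enum_val l == j) t l 0.

(* Integral over R^d with respect to Lebesgue measure, as an iterated
   one-dimensional integral; by Tonelli this is the d-dimensional integral for
   nonnegative Borel functions, the only ones it is used for. For d = 0 it is
   evaluation at the unique point. *)
Fixpoint lebesgue_integral_cV (d : nat) : ('cV[R]_d -> \bar R) -> \bar R :=
  match d with
  | 0 => fun f => f 0
  | d'.+1 => fun f =>
      (\int[@lebesgue_measure R]_x
         lebesgue_integral_cV (fun v : 'cV[R]_d' => f (col_mx (x%:M : 'M[R]_1) v)))%E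
  end.

Definition mvn_pdf d (mu : 'cV[R]_d) (Sigma : 'M[R]_d) (x : 'cV[R]_d) : R :=
  (Num.sqrt ((2 * pi) ^+ d * \det Sigma))^-1
  * expR (- (qform (invmx Sigma) (x - mu) / 2)).

End Matrices.

Section Model.
Context {R : realType}.

Definition strictly_convex (f : R -> R) : Prop :=
  forall x y t : R, x != y -> 0 < t < 1 ->
    f (t * x + (1 - t) * y) < t * f x + (1 - t) * f y.

Variables b k : R -> R.

Definition glm_density (eta y : R) : R := expR (y * eta - b eta + k y).

(* The log-likelihood of the model S is [loglik (cols X S)], that of the full
   model is [loglik X]; likewise for the Fisher information. *)
Definition loglik n d (Z : 'M[R]_(n, d)) (y : 'I_n -> R) (theta : 'cV[R]_d) : R :=
  \sum_i (y i * (Z *m theta) i 0 - b ((Z *m theta) i 0) + k (y i)).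

Definition fisher n d (Z : 'M[R]_(n, d)) (theta : 'cV[R]_d) : 'M[R]_d :=
  \sum_i derive1n 2 b ((Z *m theta) i 0) *: ((row i Z)^T *m row i Z).

Definition is_mle n d (Z : 'M[R]_(n, d)) (y : 'I_n -> R) (t : 'cV[R]_d) : Prop :=
  forall t', loglik Z y t' <= loglik Z y t.

(* The maximizer is unique when the columns of Z are linearly independent; the
   value is 0 when there is no maximizer. *)
Definition mle n d (Z : 'M[R]_(n, d)) (y : 'I_n -> R) : 'cV[R]_d :=
  xget 0 [set t | is_mle Z y t].

Section Population.
Context {dsp : measure_display} {Omega : measurableType dsp}.
Variables (P : probability Omega R).

Definition mutually_independent n (Y : 'I_n -> {RV P >-> R}) : Prop :=
  forall (J : {set 'I_n}) (B : 'I_n -> set R),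
    (forall i, measurable (B i)) ->
    P (\bigcap_(i in [set` J]) (Y i @^-1` B i))
    = (\prod_(i in J) P (Y i @^-1` B i))%E.

(* Only meaningful when the expected log-likelihood is finite, in particular
   when every k (Y i) is integrable. *)
Definition theta_star n d (Z : 'M[R]_(n, d)) (Y : 'I_n -> {RV P >-> R}) :
    'cV[R]_d :=
  xget 0 [set t | forall t',
    ('E_P[fun omega => loglik Z (fun i => Y i omega) t']
     <= 'E_P[fun omega => loglik Z (fun i => Y i omega) t])%E].

Definition fisher_star n p (X : 'M[R]_(n, p)) (Y : 'I_n -> {RV P >-> R})
    (S : {set 'I_p}) : 'M[R]_#|S| :=
  fisher (cols X S) (theta_star (cols X S) Y).

Definition zeta n p (X : 'M[R]_(n, p)) (Y : 'I_n -> {RV P >-> R})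
    (S : {set 'I_p}) : R :=
  \big[Num.max/0]_i
    l2norm (invmx (sqrtmx (fisher_star X Y S)) *m (row i (cols X S))^T).

End Population.

Section Posterior.
Variables (n p : nat) (X : 'M[R]_(n, p)).
Variables (smax : nat) (w : nat -> R) (lambda : R).

Definition model_prior (S : {set 'I_p}) : R := w #|S| / 'C(p, #|S|)%:R.

Definition slab (y : 'I_n -> R) (S : {set 'I_p}) (t : 'cV[R]_#|S|) : R :=
  let m := mle (cols X S) y in
  mvn_pdf m (invmx (lambda *: fisher (cols X S) m)) t.

(* The integral of f >= 0 against the prior; only models in the support of the
   model prior are summed over, since the others need not have a density. *)
Definition prior_integral (y : 'I_n -> R) (f : 'cV[R]_p -> R) : \bar R :=
  (\sum_(S : {set 'I_p} | (#|S| <= smax)%N)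
     (model_prior S)%:E *
     lebesgue_integral_cV (fun t : 'cV[R]_#|S| => (f (extend t) * slab y t)%:E))%E.

Definition posterior (alpha : R) (y : 'I_n -> R) (A : set 'cV[R]_p) : R :=
  fine (prior_integral y
          (fun theta => expR (alpha * loglik X y theta) * \1_A theta))
  / fine (prior_integral y
          (fun theta => expR (alpha * loglik X y theta))).

End Posterior.
End Model.

(* Main.v *)
Require Import Defs.
From mathcomp Require Import measurable_realfun complex ring lra.

Set Implicit Arguments.
Unset Strict Implicit.
Unset Printing Implicit Defensive.

Local Open Scope classical_set_scope.
Local Open Scope ring_scope.

(** Split the posterior mass of the large models as numerator over denominator, both
    divided by the likelihood at the truth raised to the power alpha, and work on the
    event where the maximum likelihood estimators are regular.

    Numerator.  There every data-dependent Gaussian slab is at most a fixed multiple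
    of a fixed Gaussian density centred at [thetabar S] ([slab_le_bound]); the price is
    the integral of this majorant, which in a model of size s is the s-th power of
    sqrt 2 * D * p^(lambda / 2) ([intcV_slab_bound]).  After this replacement the only
    randomness left is in the likelihood ratio, whose alpha-th power has mean at most
    one for every parameter ([fractional_likelihood_le1]).  By Tonelli's theorem the
    mean of the numerator is at most the prior-weighted sum of these prices over the
    large models ([integral_mass_bound_le]).  As D = p^(o(1)) and lambda < A4, each unit
    of model size costs less than p^(A4) gains in the prior, so the sum over sizes
    above K s0 is a power of p as small as desired, relative to the prior weight of
    the size s0 ([mass_over_evidence_le]).

    Denominator.  The true model alone contributes enough.  The log-likelihood at its
    maximum likelihood estimator is at least that at the truth, and around the
    estimator it decreases at most quadratically as long as no linear predictor moves
    by more than one half, by [b_dev] ([mle_gap_ge]).  On the unit ellipsoid of the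
    estimated information this leaves a truncated Gaussian integral, at least
    p^(- C s0) ([evidence_ge]).  That the unit ellipsoid is small enough follows from
    the leverage condition on [zeta], which concerns the information at the truth,
    once the estimator is known to be close to the truth: the coordinates of the
    standardized score are sub-Gaussian on the scale allowed by [zeta], so they are
    all at most a multiple of sqrt (log p) outside an event of probability 1/p
    ([small_score_prob]), and concavity of the likelihood then confines the estimator
    ([mle_localized], [mle_fisher_good]).

    The two exceptional events cost 2/p, and the ratio of the two bounds is at most
    p^(- s0) for K large ([posterior_mean_le_fixed]).

    Three points need care.  The expectation of the posterior mass is a lower
    integral, for nothing makes the posterior measurable in the data; it is bounded
    through a measurable majorant ([posterior_mean_le]).  Integrals over parameter
    vectors are iterated one-dimensional integrals, so Tonelli's theorem and the
    Gaussian integral go by induction on the dimension ([exchange_integral_intcV],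
    [intcV_gauss]).  And [theta_star] is a chosen maximizer, which has to be identified
    with the true parameter ([theta_star_true]). *)

(** * Square roots of positive semidefinite matrices *)

Section PsdSqrt.
Context {R : realType}.

Lemma qformZ m (a : R) (A : 'M[R]_m) (v : 'cV[R]_m) :
  qform (a *: A) v = a * qform A v.
Proof. by rewrite /qform -scalemxAr -scalemxAl mxE. Qed.

Lemma qformD m (A B : 'M[R]_m) (v : 'cV[R]_m) :
  qform (A + B) v = qform A v + qform B v.
Proof. by rewrite /qform mulmxDr mulmxDl mxE. Qed.

Lemma qformB m (A B : 'M[R]_m) (v : 'cV[R]_m) :
  qform (A - B) v = qform A v - qform B v.
Proof. by rewrite qformD -scaleN1r qformZ mulN1r. Qed.

Lemma qform1E m (v : 'cV[R]_m) : (v^T *m v) 0 0 = \sum_i v i 0 ^+ 2.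
Proof. by rewrite mxE; apply: eq_bigr => i _; rewrite mxE expr2. Qed.

Lemma sum_sqr_ge0 m (v : 'cV[R]_m) : 0 <= \sum_i v i 0 ^+ 2.
Proof. by apply: sumr_ge0 => i _; exact: sqr_ge0. Qed.

Lemma sum_sqr_eq0 m (v : 'cV[R]_m) : (\sum_i v i 0 ^+ 2 == 0) = (v == 0).
Proof.
apply/idP/eqP => [|->]; last by rewrite big1 // => i _; rewrite mxE expr0n.
rewrite psumr_eq0 => [/allP h|i _]; last exact: sqr_ge0.
apply/colP => i; rewrite mxE; apply/eqP.
by have := h i (mem_index_enum _); rewrite sqrf_eq0.
Qed.

Lemma l2norm_sqr m (v : 'cV[R]_m) : l2norm v ^+ 2 = \sum_i v i 0 ^+ 2.
Proof. by rewrite sqr_sqrtr ?sum_sqr_ge0. Qed.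

Lemma qform_mul_tr m n (B : 'M[R]_(m, n)) (v : 'cV[R]_n) :
  qform (B^T *m B) v = \sum_i (B *m v) i 0 ^+ 2.
Proof. by rewrite -qform1E trmx_mul /qform !mulmxA. Qed.

Lemma interpolation (s : seq R) (g : R -> R) :
  exists q : {poly R}, forall x, x \in s -> q.[x] = g x.
Proof.
elim: s => [|a s [q hq]]; first by exists 0.
have [ins|nins] := boolP (a \in s).
  by exists q => x; rewrite inE => /orP[/eqP->|]; exact: hq.
pose r : {poly R} := \prod_(x <- s) ('X - x%:P).
have ra : r.[a] != 0.
  by rewrite -rootE root_prod_XsubC.
exists (q + ((g a - q.[a]) / r.[a])%:P * r) => x; rewrite inE => /orP[/eqP->|xs].
  by rewrite !hornerE -mulrA mulVf // mulr1 addrC subrK.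
have /rootP rx : root r x by rewrite root_prod_XsubC.
by rewrite !hornerE rx mulr0 addr0 hq.
Qed.

Lemma tr_horner_mx m (A : 'M[R]_m.+1) (q : {poly R}) :
  A^T = A -> (horner_mx A q)^T = horner_mx A q.
Proof.
move=> sA; elim/poly_ind: q => [|q c ih]; first by rewrite rmorph0 trmx0.
rewrite rmorphD rmorphM /= horner_mx_X horner_mx_C linearD /= tr_scalar_mx.
by congr (_ + _); rewrite trmx_mul ih sA -[LHS]/(A * _) -[RHS]/(_ * A)
  -{1}(horner_mx_X A) -{4}(horner_mx_X A) -!rmorphM mulrC.
Qed.

Lemma psd_eigenvalue_ge0 m (A : 'M[R]_m) (a : R) :
  psdmx A -> eigenvalue A a -> 0 <= a.
Proof.
move=> [_ pA] /eigenvalueP[v vA v0].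
have := pA v^T; rewrite /qform trmxK vA -scalemxAl mxE -[X in X *m _]trmxK qform1E.
rewrite pmulr_lge0 // lt_def sum_sqr_ge0 andbT sum_sqr_eq0.
by rewrite -[0]trmx0 (inj_eq trmx_inj).
Qed.

(** The square root is a polynomial in [A]: over a closed field whose real
    elements are those of [R], [A] is unitarily diagonalisable with nonnegative
    eigenvalues in [R], and a polynomial over [R] interpolates the square roots
    of these.  Interpolating the fourth roots as well exhibits the square root
    as a square of a symmetric matrix, hence as positive semidefinite. *)
Lemma psdmx_sqrt_ex_closed (C : numClosedFieldType) (f : {rmorphism R -> C})
    (fr : forall x : R, f x \is Num.real)
    (fS : forall z : C, z \is Num.real -> exists x, z = f x) m (A : 'M[R]_m.+1) :
  psdmx A -> exists B, psdmx B /\ B *m B = A.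
Proof.
move=> pA; pose AC := map_mx f A.
have ACh : AC \is hermsymmx.
  apply: realsym_hermsym.
    by apply/is_hermitianmxP; rewrite expr0 scale1r map_mx_id // /AC map_trmx pA.1.
  by apply/mxOverP => i j; rewrite mxE.
have spr := hermitian_spectral_diag_real ACh.
have /hermitian_normalmx/orthomx_spectralP := ACh.
set P := spectralmx AC; set sp := spectral_diag AC => ACE.
have Pu : P \in unitmx by exact: spectral_unit.
have [d spE] : exists d : 'rV[R]_m.+1, sp = map_mx f d.
  have h j : exists x, sp 0 j = f x by apply: fS; exact: (mxOverP spr).
  pose g j := projT1 (cid (h j)).
  exists (\row_j g j); apply/rowP => j; rewrite !mxE.
  exact: (projT2 (cid (h j))).
have d_ge0 j : 0 <= d 0 j.
  apply: (psd_eigenvalue_ge0 pA).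
  rewrite eigenvalue_root_char -(fmorph_root f) map_char_poly -eigenvalue_root_char.
  apply/eigenvalueP; exists (row j P); last first.
    apply/eqP => r0; have := Pu; rewrite unitmxE unitfE.
    by rewrite (expand_det_row _ j) big1 ?eqxx // => k _; move/rowP/(_ k): r0;
      rewrite !mxE => ->; rewrite mul0r.
  rewrite -/AC ACE -row_mul !mulmxA mulmxV // mul1mx row_mul.
  rewrite row_diag_mx -scalemxAl -rowE spE mxE; by congr (_ *: _).
have hq q : map_mx f (horner_mx A q)
    = invmx P *m diag_mx (map_mx f (map_mx (horner q) d)) *m P.
  rewrite map_horner_mx -/AC {1}ACE horner_mx_uconjC // horner_mx_diag.
  congr (_ *m diag_mx _ *m _); rewrite spE -!map_mx_comp.
  by apply/rowP => j; rewrite !mxE /= horner_map.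
have hmul q1 q2 : (forall j, q1.[d 0 j] ^+ 2 = q2.[d 0 j]) ->
    horner_mx A q1 *m horner_mx A q1 = horner_mx A q2.
  move=> h; rewrite -[LHS]/(_ * _) -rmorphM; apply: (@map_mx_inj _ _ f).
  rewrite !hq; congr (_ *m diag_mx (map_mx _ _) *m _).
  by apply/rowP => j; rewrite !mxE hornerM -expr2.
have [q1 h1] := interpolation [seq d 0 j | j : 'I_m.+1] (fun x => Num.sqrt x).
have [q2 h2] := interpolation [seq d 0 j | j : 'I_m.+1]
   (fun x => Num.sqrt (Num.sqrt x)).
have dm j : d 0 j \in [seq d 0 j | j : 'I_m.+1] by apply/mapP; exists j; rewrite ?mem_enum.
exists (horner_mx A q1); split; last first.
  rewrite (hmul _ 'X) ?horner_mx_X // => j.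
  by rewrite h1 // hornerX sqr_sqrtr.
split; first by rewrite tr_horner_mx // pA.1.
move=> v; rewrite -(hmul q2) => [|j]; last first.
  by rewrite h1 // h2 // sqr_sqrtr // sqrtr_ge0.
have {1}<- := tr_horner_mx q2 pA.1.
by rewrite qform_mul_tr sum_sqr_ge0.
Qed.

Lemma psdmx_sqrt_ex m (A : 'M[R]_m) :
  psdmx A -> exists B, psdmx B /\ B *m B = A.
Proof.
case: m A => [|m] A pA.
  by exists A; split=> //; apply/matrixP; case.
apply: (@psdmx_sqrt_ex_closed R[i] (real_complex R)) pA => [x|z].
  by apply/complex_realP; exists x.
by move/complex_realP.
Qed.

Lemma sqrtmxP m (A : 'M[R]_m) :
  psdmx A -> psdmx (sqrtmx A) /\ sqrtmx A *m sqrtmx A = A.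
Proof.
move=> /psdmx_sqrt_ex [B hB].
exact: (@xgetPex _ 0 [set B | psdmx B /\ B *m B = A] (ex_intro _ B hB)).
Qed.

Lemma qform_sqrtmx m (A : 'M[R]_m) (v : 'cV[R]_m) :
  psdmx A -> qform A v = l2norm (sqrtmx A *m v) ^+ 2.
Proof.
move=> /sqrtmxP[[sB _] BB]; rewrite l2norm_sqr -qform_mul_tr sB BB //.
Qed.

End PsdSqrt.

(** * Iterated Lebesgue integrals depending on a parameter *)

Section IteratedIntegral.
Context {R : realType}.
Local Open Scope ereal_scope.

Local Notation intcV := (@lebesgue_integral_cV R _).

Lemma intcV_ge0 d (f : 'cV[R]_d -> \bar R) : (forall v, 0 <= f v) -> 0 <= intcV f.
Proof.
elim: d f => [|d ih] f f0 /=; first exact: f0.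
by apply: integral_ge0 => x _; apply: ih.
Qed.

Lemma intcV0 d : intcV (fun _ : 'cV[R]_d => 0) = 0.
Proof. by elim: d => //= d ih; under eq_integral do rewrite ih; exact: integral0. Qed.

(** The integral of a nonnegative function is a supremum over the simple
    functions below it, so monotonicity holds without measurability. *)
Lemma ge0_le_integral_lower {dsp} {T : measurableType dsp}
    (mu : {measure set T -> \bar R}) (f g : T -> \bar R) :
  (forall x, 0 <= f x) -> (forall x, f x <= g x) ->
  \int[mu]_x f x <= \int[mu]_x g x.
Proof.
move=> f0 fg.
have g0 x : 0 <= g x by exact: le_trans (f0 x) (fg x).
rewrite !ge0_integralTE //.
apply: le_ereal_sup => _ [h /= hf <-]; exists h => // x.
exact: le_trans (hf x) (fg x).
Qed.

Lemma le_intcV d (f g : 'cV[R]_d -> \bar R) :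
  (forall v, 0 <= f v) -> (forall v, f v <= g v) -> intcV f <= intcV g.
Proof.
elim: d f g => [|d ih] f g f0 fg /=; first exact: fg.
apply: ge0_le_integral_lower => x; first exact: intcV_ge0.
by apply: ih => v; [exact: f0|exact: fg].
Qed.

(** Measurability in a parameter and a vector jointly, tested by substituting
    measurable functions for both; this avoids a sigma-algebra on column
    vectors and is stable under peeling off a coordinate. *)
Definition jointly_measurable d {dsp} {T : measurableType dsp}
    (f : T -> 'cV[R]_d -> \bar R) : Prop :=
  forall (dsp' : measure_display) (T' : measurableType dsp') (tau : T' -> T)
    (g : 'I_d -> T' -> R),
    measurable_fun setT tau -> (forall i, measurable_fun setT (g i)) ->
    measurable_fun setT (fun t => f (tau t) (\col_i g i t)).

Definition peel d (T : Type) (f : T -> 'cV[R]_d.+1 -> \bar R) (tx : T * R)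
    (v : 'cV[R]_d) : \bar R :=
  f tx.1 (col_mx (tx.2%:M : 'M[R]_1) v).

Lemma peel_ge0 d (T : Type) (f : T -> 'cV[R]_d.+1 -> \bar R) :
  (forall t v, 0 <= f t v) -> forall tx v, 0 <= peel f tx v.
Proof. by move=> f0 tx v; exact: f0. Qed.

Lemma jointly_measurable_peel d {dsp} {T : measurableType dsp}
    (f : T -> 'cV[R]_d.+1 -> \bar R) :
  jointly_measurable f -> @jointly_measurable d _ (T * R)%type (peel f).
Proof.
move=> mf dsp' T' tau g mtau mg.
pose g' (i : 'I_(1 + d)) (t : T') : R :=
  match fintype.split i with inl _ => (tau t).2 | inr j => g j t end.
rewrite (_ : (fun t => peel _ _ _) = fun t => f (tau t).1 (\col_i g' i t)); last first.
  apply/funext => t; congr (f _ _); apply/colP => i; rewrite !mxE /g'.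
  by case: splitP => j _; rewrite !mxE // ord1 mulr1n.
apply: mf; first exact: measurableT_comp.
by move=> i; rewrite /g'; case: splitP => j _; [exact: measurableT_comp|exact: mg].
Qed.

Lemma jointly_measurable_sub d {dsp} {T : measurableType dsp}
    {dsp'} {T' : measurableType dsp'} (tau : T' -> T)
    (f : T -> 'cV[R]_d -> \bar R) :
  measurable_fun setT tau -> jointly_measurable f ->
  jointly_measurable (fun t => f (tau t)).
Proof.
move=> mtau mf dsp2 T2 s g ms mg.
exact: (mf _ _ (tau \o s) g (measurableT_comp mtau ms) mg).
Qed.

Lemma measurable_intcV d {dsp} {T : measurableType dsp}
    (f : T -> 'cV[R]_d -> \bar R) :
  (forall t v, 0 <= f t v) -> jointly_measurable f ->
  measurable_fun setT (fun t => intcV (f t)).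
Proof.
elim: d dsp T f => [|d ih] dsp T f f0 mf /=.
  have := mf _ _ id (fun _ _ => 0%R) (@measurable_id _ _ _) (fun _ => measurable_cst _).
  by congr (measurable_fun _ _); apply/funext => t; congr (f _ _); apply/colP; case.
have m2 := ih _ _ _ (peel_ge0 f0)
  (jointly_measurable_peel mf).
apply: (measurable_fun_fubini_tonelli_F (m2 := @lebesgue_measure R)
  (fun tx => intcV (peel f tx))) => // tx.
by apply: intcV_ge0 => v; exact: f0.
Qed.

Lemma intcV_measurable_head d {dsp} {T : measurableType dsp}
    (f : T -> 'cV[R]_d.+1 -> \bar R) t :
  (forall t v, 0 <= f t v) -> jointly_measurable f ->
  measurable_fun [set: R] (fun x => intcV (fun v => f t (col_mx (x%:M : 'M[R]_1) v))).
Proof.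
move=> f0 mf.
have mt : measurable_fun [set: R] (fun x : R => (t, x)).
  by apply: measurable_fun_pair => //; exact: measurable_cst.
have := measurable_intcV (fun (x : R) v => f0 t (col_mx (x%:M : 'M[R]_1) v))
  (jointly_measurable_sub mt (jointly_measurable_peel mf)).
by [].
Qed.

Lemma exchange_integral_intcV d {dsp} {T : measurableType dsp}
    (mu : {sigma_finite_measure set T -> \bar R})
    (f : T -> 'cV[R]_d -> \bar R) :
  (forall t v, 0 <= f t v) -> jointly_measurable f ->
  \int[mu]_t intcV (f t) = intcV (fun v => \int[mu]_t f t v).
Proof.
elim: d f => [|d ih] f f0 mf //=.
have m2 := measurable_intcV (peel_ge0 f0) (jointly_measurable_peel mf).
have := fubini_tonelli (m1 := mu) (m2 := @lebesgue_measure R)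
  (fun tx => intcV (peel f tx)) m2 (fun tx => intcV_ge0 (peel_ge0 f0 tx)).
move=> ->.
apply: eq_integral => x _ /=; apply: ih => [t v|]; first exact: f0.
have mx : measurable_fun [set: T] (fun t : T => (t, x : R)).
  by apply: measurable_fun_pair => //; exact: measurable_cst.
exact: (jointly_measurable_sub mx (jointly_measurable_peel mf)).
Qed.

Lemma intcVD d {dsp} {T : measurableType dsp} (f g : T -> 'cV[R]_d -> \bar R) t :
  (forall t v, 0 <= f t v) -> jointly_measurable f ->
  (forall t v, 0 <= g t v) -> jointly_measurable g ->
  intcV (fun v => f t v + g t v) = intcV (f t) + intcV (g t).
Proof.
elim: d dsp T f g t => [|d ih] dsp T f g t f0 mf g0 mg //=.
rewrite -ge0_integralD //; first last.
- exact: intcV_measurable_head.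
- by move=> x _; exact: intcV_ge0.
- exact: intcV_measurable_head.
- by move=> x _; exact: intcV_ge0.
apply: eq_integral => x _ /=.
exact: (ih _ _ _ _ (t, x) (peel_ge0 f0)
  (jointly_measurable_peel mf)
  (peel_ge0 g0) (jointly_measurable_peel mg)).
Qed.

Lemma intcVZ d {dsp} {T : measurableType dsp} (c : R) (f : T -> 'cV[R]_d -> \bar R) t :
  (0 <= c)%R -> (forall t v, 0 <= f t v) -> jointly_measurable f ->
  intcV (fun v => c%:E * f t v) = c%:E * intcV (f t).
Proof.
move=> c0; elim: d dsp T f t => [|d ih] dsp T f t f0 mf //=.
rewrite -ge0_integralZl //; first last.
- by move=> x _; exact: intcV_ge0.
- exact: intcV_measurable_head.
apply: eq_integral => x _ /=.
exact: (ih _ _ _ (t, x) (peel_ge0 f0)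
  (jointly_measurable_peel mf)).
Qed.

End IteratedIntegral.

(** * Gaussian integrals *)

Section Gaussian.
Context {R : realType}.

Local Notation intcV := (@lebesgue_integral_cV R _).

Definition posdefmx m (A : 'M[R]_m) : Prop :=
  A^T = A /\ forall v : 'cV[R]_m, v != 0 -> 0 < qform A v.

Lemma qform0 m (A : 'M[R]_m) : qform A 0 = 0.
Proof. by rewrite /qform mulmx0 mxE. Qed.

Lemma posdef_psd m (A : 'M[R]_m) : posdefmx A -> psdmx A.
Proof.
move=> [sA pA]; split=> // v; have [->|v0] := eqVneq v 0; first by rewrite qform0.
exact/ltW/pA.
Qed.

Lemma posdefmxZ m (c : R) (A : 'M[R]_m) : 0 < c -> posdefmx A -> posdefmx (c *: A).
Proof.
move=> c0 [sA pA]; split; first by rewrite linearZ /= sA.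
by move=> v v0; rewrite qformZ mulr_gt0 // pA.
Qed.

Lemma posdefmx_ge m (A B : 'M[R]_m) :
  posdefmx A -> loewner_le A B -> B^T = B -> posdefmx B.
Proof.
move=> [_ pA] [_ AB] sB; split=> // v v0; have := AB v.
by rewrite qformB subr_ge0; apply: lt_le_trans; exact: pA.
Qed.

Lemma psd_unit_posdef m (A : 'M[R]_m) : psdmx A -> A \in unitmx -> posdefmx A.
Proof.
move=> pA Au; split; first exact: pA.1.
move=> v v0; rewrite lt_def pA.2 andbT; apply: contra v0.
rewrite qform_sqrtmx // l2norm_sqr sum_sqr_eq0 => /eqP h.
have [_ BB] := sqrtmxP pA.
by rewrite -[v](mulKmx Au) -{2}BB -mulmxA h !mulmx0.
Qed.

Lemma measurable_qform d {dsp} {T : measurableType dsp} (A : 'M[R]_d)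
    (g : T -> 'cV[R]_d) :
  (forall i, measurable_fun setT (fun t => g t i 0)) ->
  measurable_fun setT (fun t => qform A (g t)).
Proof.
move=> mg; rewrite (_ : (fun t => _) =
    fun t => \sum_j (\sum_i g t i 0 * A i j) * g t j 0); last first.
  apply/funext => t; rewrite /qform mxE; apply: eq_bigr => j _.
  by rewrite mxE; congr (_ * _); apply: eq_bigr => i _; rewrite mxE.
apply: measurable_sum => j; apply: measurable_funM => //.
by apply: measurable_sum => i; apply: measurable_funM.
Qed.

Lemma jointly_measurable_gauss d {dsp} {T : measurableType dsp} (A : 'M[R]_d)
    (mu : 'cV[R]_d) :
  jointly_measurable (fun (_ : T) v => (expR (- (qform A (v - mu) / 2)))%:E).
Proof.
move=> dsp' T' tau g mtau mg; apply/measurable_EFinP.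
apply: measurableT_comp => //; apply: measurableT_comp => //.
apply: measurable_funM => //; apply: measurable_qform => i.
rewrite (_ : (fun t => _) = fun t => g i t - mu i 0); last first.
  by apply/funext => t; rewrite !mxE.
exact: measurable_funB.
Qed.

Lemma integral_gauss1 (a m : R) : 0 < a ->
  (\int[@lebesgue_measure R]_x (expR (- (a * (x - m) ^+ 2 / 2)))%:E
   = (Num.sqrt (2 * pi / a))%:E)%E.
Proof.
move=> a0; pose s := Num.sqrt a^-1.
have s0 : s != 0 by rewrite gt_eqF // sqrtr_gt0 invr_gt0.
have s2 : s ^+ 2 = a^-1 by rewrite sqr_sqrtr // invr_ge0 ltW.
have pk : 0 < normal_peak s by exact: normal_peak_gt0.
have := integral_normal_pdf m s.
under eq_integral => x _.
  rewrite normal_pdfE // /normal_fun s2 EFinM.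
  rewrite (_ : - (x - m) ^+ 2 / (a^-1 *+ 2) = - (a * (x - m) ^+ 2 / 2)); last first.
    by field; rewrite gt_eqF.
  over.
rewrite /= ge0_integralZl //; first last.
- by rewrite lee_fin ltW.
- apply/measurable_EFinP; apply: measurableT_comp => //; apply: measurableT_comp => //.
  apply: measurable_funM => //; apply: measurable_funM => //.
  by apply: measurable_funX; exact: measurable_funB.
have -> : normal_peak s = (Num.sqrt (2 * pi / a))^-1.
  by rewrite /normal_peak s2; congr (Num.sqrt _)^-1; field; rewrite gt_eqF.
have q0 : 0 < Num.sqrt (2 * pi / a) by rewrite sqrtr_gt0 divr_gt0 // mulr_gt0 // pi_gt0.
move=> /(congr1 (fun z => (Num.sqrt (2 * pi / a))%:E * z)%E).
by rewrite muleA -EFinM mulfV ?gt_eqF // mul1e mule1.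
Qed.

(** The Gaussian integral, by completing the square in one coordinate at a
    time: integrating out the last coordinates leaves the Schur complement. *)
Lemma intcV_gauss d (A : 'M[R]_d) (mu : 'cV[R]_d) : posdefmx A ->
  0 < \det A /\
  intcV (fun v => (expR (- (qform A (v - mu) / 2)))%:E)
    = (Num.sqrt ((2 * pi) ^+ d / \det A))%:E.
Proof.
elim: d A mu => [|d ih] A mu [sA pA].
  rewrite det_mx00 /= expr0 invr1 mulr1 sqrtr1; split=> //.
  by rewrite /qform mxE big_ord0 mul0r oppr0 expR0.
move: A mu sA pA; rewrite -[d.+1]/(1 + d)%N => A mu sA pA.
pose a : R := A 0 0; pose u : 'cV[R]_d := dlsubmx A; pose C := drsubmx A.
have AE : A = block_mx (a%:M : 'M[R]_1) u^T u C.
  rewrite -{1}(submxK A); congr block_mx.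
    by apply/matrixP => i j; rewrite !ord1 !mxE eqxx mulr1n /a; congr (A _ _);
       apply/val_inj.
  by rewrite /u trmx_dlsub sA.
have sC : C^T = C by rewrite /C trmx_drsub sA.
have qA0 v : qform A (col_mx 0 v) = qform C v.
  rewrite /qform AE tr_col_mx mul_row_block trmx0 !mul0mx !add0r.
  by rewrite mul_row_col mulmx0 add0r.
have pC : posdefmx C.
  split=> // v v0; rewrite -qA0; apply: pA; apply: contra v0 => /eqP h.
  by have := congr1 dsubmx h; rewrite col_mxKd linear0 => ->.
have [detC _] := ih C 0 pC.
have Cu : C \in unitmx by rewrite unitmxE unitfE gt_eqF.
pose w := invmx C *m u.
have Cw : C *m w = u by rewrite mulKVmx.
have wC : w^T *m C = u^T by rewrite -[in LHS]sC -trmx_mul Cw.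
(* the Schur complement of [C] *)
pose s := a - (u^T *m w) 0 0.
have wu : w^T *m u = u^T *m w by rewrite -{1}Cw mulmxA wC.
have qA (x : R) v : qform A (col_mx (x%:M : 'M[R]_1) v) = s * x ^+ 2 + qform C (v + x *: w).
  rewrite /qform AE tr_col_mx mul_row_block mul_row_col tr_scalar_mx.
  rewrite !mul_scalar_mx !mul_mx_scalar.
  have -> : (v + x *: w)^T = v^T + x *: w^T by rewrite linearD linearZ.
  rewrite !mulmxDl !mulmxDr -!scalemxAl -!scalemxAr wC.
  rewrite -(mulmxA _ C w) Cw.
  rewrite (_ : u^T *m v = v^T *m u); last first.
    by apply/matrixP => i j; rewrite !ord1 -[in LHS](trmxK v) -trmx_mul mxE.
  rewrite !mxE /s !mxE eqxx mulr1n; set y1 := \sum_j _; set y2 := \sum_j _.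
  by ring.
(* the form takes the value [s] at the vector that kills the second square *)
have s0 : 0 < s.
  have := pA (col_mx (1%:M : 'M[R]_1) (- w)); rewrite qA scale1r addNr qform0 addr0.
  rewrite expr1n mulr1; apply; apply/eqP => /(congr1 usubmx).
  rewrite col_mxKu linear0 => /matrixP/(_ 0 0); rewrite !mxE => /eqP.
  by rewrite oner_eq0.
have detA : \det A = s * \det C.
  have : \det (A *m block_mx (1%:M : 'M[R]_1) 0 (- w) 1%:M) = s * \det C.
    rewrite {1}AE mulmx_block !mulmx1 !mulmx0 !add0r !mulmxN Cw subrr.
    rewrite det_ublock; congr (_ * _).
    by rewrite det_mx11 /s; move: (u^T *m w) => z; rewrite !mxE eqxx mulr1n.
  by rewrite det_mulmx det_lblock !det1 !mulr1.
split; first by rewrite detA mulr_gt0.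
pose m1 := mu 0 0; pose m2 := dsubmx mu.
have muE : mu = col_mx (m1%:M : 'M[R]_1) m2.
  rewrite -{1}(vsubmxK mu); congr col_mx.
  by apply/matrixP => i j; rewrite !ord1 !mxE eqxx mulr1n /m1; congr (mu _ _);
    apply/val_inj.
rewrite /=.
under eq_integral => x _.
  rewrite (_ : (fun v : 'cV[R]_d => _) = fun v =>
     ((expR (- (s * (x - m1) ^+ 2 / 2)))%:E
      * (expR (- (qform C (v - (m2 - (x - m1) *: w)) / 2)))%:E)%E); last first.
    apply/funext => v; rewrite -EFinM -expRD; congr (expR _)%:E.
    rewrite muE opp_col_mx add_col_mx -raddfN -raddfD /= qA.
    by rewrite opprB addrA mulrDl opprD [v + _ - _]addrAC addrC.
  rewrite (@intcVZ R d _ unit _ (fun _ v =>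
    (expR (- (qform C (v - (m2 - (x - m1) *: w)) / 2)))%:E) tt) ?expR_ge0 //; last first.
    exact: jointly_measurable_gauss.
  rewrite (ih C _ pC).2.
  over.
rewrite /= ge0_integralZr //; first last.
- apply/measurable_EFinP; apply: measurableT_comp => //; apply: measurableT_comp => //.
  apply: measurable_funM => //; apply: measurable_funM => //.
  by apply: measurable_funX; exact: measurable_funB.
rewrite integral_gauss1 // -EFinM -sqrtrM ?divr_ge0 ?mulr_ge0 ?pi_ge0 // ?ltW //.
congr (Num.sqrt _)%:E; rewrite detA exprS; field.
by rewrite !gt_eqF.
Qed.

Lemma det_posdef_gt0 d (A : 'M[R]_d) : posdefmx A -> 0 < \det A.
Proof. by move=> /(intcV_gauss 0)[]. Qed.

(** Comparing the Gaussian integrals of the two forms. *)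
Lemma det_loewner_le d (A B : 'M[R]_d) :
  posdefmx A -> posdefmx B -> loewner_le A B -> \det A <= \det B.
Proof.
move=> pA pB [_ AB].
have [dA iA] := intcV_gauss 0 pA; have [dB iB] := intcV_gauss 0 pB.
have : (intcV (fun v => (expR (- (qform B (v - 0) / 2)))%:E)
        <= intcV (fun v => (expR (- (qform A (v - 0) / 2)))%:E))%E.
  apply: le_intcV => v; rewrite lee_fin ?expR_ge0 // ler_expR lerN2.
  by rewrite ler_pM2r // -subr_ge0 -qformB AB.
have t0 : 0 < (2 * pi : R) ^+ d by rewrite exprn_gt0 // mulr_gt0 // pi_gt0.
rewrite iA iB lee_fin ler_psqrt ?nnegrE ?divr_ge0 ?(ltW t0, ltW dA, ltW dB) //.
by rewrite ler_pM2l // lef_pV2.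
Qed.

End Gaussian.

(** * Transfer of integrals along weighted images *)

Section WeightedPushforward.
Context {R : realType} {d1 d2 : measure_display}.
Context {T : measurableType d1} {S : measurableType d2}.
Variables (mu : {measure set T -> \bar R}) (m : {measure set S -> \bar R}).
Variables (phi : T -> S) (g : T -> R).
Hypotheses (mphi : measurable_fun setT phi) (mg : measurable_fun setT g).
Hypothesis g0 : forall x, 0 <= g x.
Hypothesis mE : forall B, measurable B ->
  (\int[mu]_x ((g x)%:E * (\1_B (phi x))%:E) = m B)%E.
Local Open Scope ereal_scope.
Import HBNNSimple.

(** If the image under [phi] of the measure with density [g] is [m], integrals
    transfer: this holds for indicators, hence for simple functions, hence for
    monotone limits of these. *)
Lemma ge0_integral_weighted_pushforward (f : S -> \bar R) :
  measurable_fun setT f -> (forall y, 0 <= f y) ->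
  \int[mu]_x ((g x)%:E * f (phi x)) = \int[m]_y f y.
Proof.
move=> mf f0; pose f_ := nnsfun_approx measurableT mf.
have fcvg y : (f_ n y)%:E @[n --> \oo] --> f y.
  exact: (cvg_nnsfun_approx measurableT mf (fun x _ => f0 x)).
have fnd y : {homo (fun n => (f_ n y)%:E) : a b / (a <= b)%N >-> a <= b}.
  by move=> a b ab; rewrite lee_fin; exact/lefP/nd_nnsfun_approx.
have simple (h : {nnsfun S >-> R}) :
    \int[mu]_x ((g x)%:E * (h (phi x))%:E) = \int[m]_y (h y)%:E.
  rewrite integralT_nnsfun sintegralE.
  transitivity (\int[mu]_x (\sum_(r \in range h)
      (r%:E * ((g x)%:E * (\1_(h @^-1` [set r]) (phi x))%:E)))).
    apply: eq_integral => x _; rewrite fimfunE -fsumEFin // ge0_mule_fsumr //.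
      by apply: eq_fsbigr => r _; rewrite EFinM muleCA.
    by move=> r; rewrite lee_fin; exact: nnfun_muleindic_ge0.
  have mh r : measurable_fun setT
      (fun x => (g x)%:E * (\1_(h @^-1` [set r]) (phi x))%:E).
    have mi : measurable_fun setT (\1_(h @^-1` [set r]) : S -> R).
      exact: measurable_indic.
    apply: emeasurable_funM; apply/measurable_EFinP => //.
    exact: (measurableT_comp mi mphi).
  have h0 r x : 0 <= (g x)%:E * (\1_(h @^-1` [set r]) (phi x))%:E.
    by rewrite mule_ge0 // lee_fin.
  have rh0 (r : R) : r \in range h -> 0 <= (r%:E : \bar R).
    by rewrite inE => -[y _ <-]; rewrite lee_fin.
  (* the values of [h] are nonnegative, but exchanging sum and integral asks for
     nonnegative factors at all reals *)
  rewrite (eq_integral (fun x => \sum_(r \in range h)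
      ((Num.max 0 r)%:E * ((g x)%:E * (\1_(h @^-1` [set r]) (phi x))%:E)))); last first.
    move=> x _; apply: eq_fsbigr => r /rh0.
    by rewrite lee_fin => /max_idPr ->.
  rewrite ge0_integral_fsum //.
  - apply: eq_fsbigr => r rh; have := rh0 r rh; rewrite lee_fin => r0.
    rewrite ge0_integralZl //; last by rewrite lee_fin le_max lexx.
    by rewrite (max_idPr r0) mE.
  - by move=> r; exact: measurable_funeM.
  - by move=> r x _; rewrite mule_ge0 // lee_fin le_max lexx.
transitivity (\int[mu]_x limn (fun n => (g x)%:E * (f_ n (phi x))%:E)).
  apply: eq_integral => x _; apply/esym/cvg_lim => //.
  exact: cvgeZl.
rewrite monotone_convergence //; last 3 first.
- move=> n; apply: emeasurable_funM; apply/measurable_EFinP => //.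
  by apply: measurableT_comp => //.
- by move=> n x _; rewrite mule_ge0 // lee_fin.
- by move=> x _ a b ab; apply: lee_wpmul2l; [rewrite lee_fin|exact: fnd].
transitivity (\int[m]_y limn (fun n => (f_ n y)%:E)); last first.
  by apply: eq_integral => y _; exact/cvg_lim.
rewrite monotone_convergence //; last 2 first.
- by move=> n; exact/measurable_EFinP.
- by move=> n x _; rewrite lee_fin.
by congr (limn _); apply/funext => n; exact: simple.
Qed.

End WeightedPushforward.

(** * Products over independent observations *)

Section IndependentProduct.
Context {R : realType} {dsp : measure_display} {Omega : measurableType dsp}.
Variables (P : probability Omega R) (n : nat) (Y : 'I_n -> {RV P >-> R}).
Hypothesis Y_indep : mutually_independent Y.
Local Open Scope ereal_scope.

(** Mutual independence is the case where all factors are indicators; an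
    indicator is replaced by a general factor one index at a time. *)
Lemma integral_prod_indep_upto (m : nat) (f : 'I_n -> R -> R) (c : 'I_n -> R) :
  (forall i, measurable_fun setT (f i)) -> (forall i y, 0 <= f i y)%R ->
  (forall i, \int[P]_w (f i (Y i w))%:E = (c i)%:E) ->
  (forall i : 'I_n, (m <= i)%N ->
     exists2 B : set R, measurable B & f i = \1_B) ->
  \int[P]_w (\prod_i f i (Y i w))%:E = (\prod_i c i)%:E.
Proof.
elim: m f c => [|m ih] f c mf f0 fc f_indic.
  have [B hB] : {B : 'I_n -> set R | forall i, measurable (B i) /\ f i = \1_(B i)}.
    have h i : exists B, measurable B /\ f i = \1_B.
      by have [B mB fB] := f_indic i (leq0n i); exists B.
    exists (fun i => projT1 (cid (h i))) => i.
    exact: (projT2 (cid (h i))).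
  have PB i : P (Y i @^-1` B i) = (c i)%:E.
    rewrite -fc (hB i).2; apply/esym.
    transitivity (\int[P]_w (\1_(Y i @^-1` B i) w)%:E) => //.
    rewrite integral_indic ?setIT //.
    by rewrite -[X in measurable X]setTI; apply: measurable_funP => //; exact: (hB i).1.
  rewrite (eq_integral (fun w =>
      (\1_(\bigcap_(i in [set` [set: 'I_n]%SET]) (Y i @^-1` B i)) w)%:E)); last first.
    move=> w _; congr EFin; rewrite indicE.
    under eq_bigr => i _ do rewrite (hB i).2 indicE.
    have [h|h] := pselect (forall i, B i (Y i w)).
      rewrite big1 => [|i _]; last by rewrite mem_set.
      by rewrite mem_set // => i _; exact: h.
    rewrite memNset => [|h']; last by apply: h => i; apply: h'; rewrite /= inE.
    move/existsNP: h => [i h]; apply/eqP/prodf_eq0.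
    by exists i => //; rewrite memNset.
  rewrite integral_indic // ?setIT; last first.
    apply: fin_bigcap_measurable => // i _.
    by rewrite -[X in measurable X]setTI; apply: measurable_funP => //; exact: (hB i).1.
  transitivity (\prod_(i in [set: 'I_n]%SET) P (Y i @^-1` B i)).
    by apply: Y_indep => i; exact: (hB i).1.
  rewrite (eq_bigr (fun i => (c i)%:E)) => [|i _]; last exact: PB.
  by rewrite -prodEFin; apply: eq_bigl => i; rewrite inE.
have [mn|nm] := ltnP m n; last first.
  apply: ih => // i mi; by have := leq_ltn_trans (leq_trans nm mi) (ltn_ord i); rewrite ltnn.
pose j := Ordinal mn.
have c0 i : (0 <= c i)%R.
  by rewrite -lee_fin -fc; apply: integral_ge0 => w _; rewrite lee_fin.
pose c' : R := (\prod_(i | i != j) c i)%R.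
have c'0 : (0 <= c')%R by apply: prodr_ge0.
pose g w := (\prod_(i | i != j) f i (Y i w))%R.
rewrite (eq_integral (fun w => (g w)%:E * (f j (Y j w))%:E)); last first.
  by move=> w _; rewrite (bigD1 j) //= -EFinM mulrC.
pose mj := mscale (NngNum c'0) (distribution P (Y j)).
have mYj : measurable_fun setT (Y j) by exact: measurable_funP.
have mg : measurable_fun setT g.
  rewrite /g (_ : (fun w => _) = fun w => (\prod_i (if i != j then f i (Y i w) else 1))%R).
    by apply: measurable_prod => i _; case: (i != j) => //; exact: measurableT_comp.
  by apply/funext => w; rewrite big_mkcond.
have g0 w : (0 <= g w)%R by apply: prodr_ge0.
have mE (B : set R) : measurable B ->
    \int[P]_w ((g w)%:E * (\1_B (Y j w))%:E) = mj B.
  move=> mB; pose f' i := if i == j then \1_B : R -> R else f i.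
  pose cc i := if i == j then fine (P (Y j @^-1` B)) else c i.
  have mYB : measurable (Y j @^-1` B).
    by rewrite -[X in measurable X]setTI; exact: mYj.
  transitivity (\int[P]_w (\prod_i f' i (Y i w))%:E).
    apply: eq_integral => w _; rewrite [in RHS](bigD1 j) //= /f' eqxx -EFinM mulrC.
    by congr ((_ * _)%R%:E); apply: eq_bigr => i /negPf ->.
  rewrite (ih f' cc).
  - rewrite (bigD1 j) //= /cc eqxx /mj /mscale /= mulrC EFinM fineK ?fin_num_measure //.
    by congr (_%:E * _); apply: eq_bigr => i /negPf ->.
  - by move=> i; rewrite /f'; case: ifP => _ //; exact: measurable_indic.
  - by move=> i y; rewrite /f'; case: ifP.
  - move=> i; rewrite /f' /cc; case: eqP => [->|_] //.
    rewrite fineK ?fin_num_measure //.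
    transitivity (\int[P]_w (\1_(Y j @^-1` B) w)%:E) => //.
    by rewrite integral_indic ?setIT.
  - move=> i mi; rewrite /f'; case: eqP => [_|/eqP ij]; first by exists B.
    apply: f_indic; rewrite ltn_neqAle mi andbT; apply: contra ij => /eqP h.
    by apply/eqP/val_inj.
have mfj : measurable_fun setT (fun y => (f j y)%:E) by exact/measurable_EFinP.
have fj0 y : 0 <= (f j y)%:E by rewrite lee_fin.
transitivity (\int[mj]_y (f j y)%:E).
  exact: (ge0_integral_weighted_pushforward mYj mg g0 mE mfj fj0).
rewrite ge0_integral_mscale //= ge0_integral_distribution //.
by rewrite fc [in RHS](bigD1 j) //= mulrC EFinM.
Qed.

Lemma integral_prod_indep (f : 'I_n -> R -> R) (c : 'I_n -> R) :
  (forall i, measurable_fun setT (f i)) -> (forall i y, 0 <= f i y)%R ->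
  (forall i, \int[P]_w (f i (Y i w))%:E = (c i)%:E) ->
  \int[P]_w (\prod_i f i (Y i w))%:E = (\prod_i c i)%:E.
Proof.
move=> mf f0 fc; apply: (integral_prod_indep_upto (m := n)) => // i.
by rewrite leqNgt ltn_ord.
Qed.

End IndependentProduct.

(** * Exponential moments in an exponential family *)

Section ExponentialFamily.
Context {R : realType} {dsp : measure_display} {Omega : measurableType dsp}.
Variables (nu : {sigma_finite_measure set R -> \bar R}) (b k : R -> R).
Hypothesis k_meas : measurable_fun setT k.
Hypothesis family_density : forall eta : R,
  (\int[nu]_y (glm_density b k eta y)%:E)%E = 1%E.
Variable P : probability Omega R.
Local Open Scope ereal_scope.

Definition has_glm_law (Y : {RV P >-> R}) (eta : R) : Prop :=
  forall B : set R, measurable B ->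
    P (Y @^-1` B) = \int[nu]_(y in B) (glm_density b k eta y)%:E.

Lemma measurable_glm_density eta : measurable_fun setT (glm_density b k eta).
Proof.
apply: measurableT_comp => //; apply: measurable_funD => //.
by apply: measurable_funB => //; exact: measurable_funM.
Qed.

(** Tilting by [exp (delta y)] moves the natural parameter by [delta], and all
    members of the family have total mass one. *)
Lemma glm_mgf (Y : {RV P >-> R}) eta delta : has_glm_law Y eta ->
  \int[P]_w (expR (delta * Y w))%:E = (expR (b (eta + delta) - b eta))%:E.
Proof.
move=> Y_law.
have md := measurable_glm_density eta.
have d0 y : (0 <= glm_density b k eta y)%R by exact: expR_ge0.
have mexp : measurable_fun [set: R] (fun y : R => (expR (delta * y))%:E).
  by apply/measurable_EFinP; apply: measurableT_comp => //; exact: measurable_funM.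
have exp0 (y : R) : 0 <= (expR (delta * y))%:E by rewrite lee_fin expR_ge0.
have mE (B : set R) : measurable B ->
    \int[nu]_x ((glm_density b k eta x)%:E * (\1_B (idfun x))%:E)
      = distribution P Y B.
  move=> mB; rewrite /distribution /pushforward Y_law // [in RHS]integral_mkcond.
  apply: eq_integral => y _; rewrite patchE indicE.
  by case: ifPn => _; rewrite ?mule1 ?mule0.
transitivity (\int[distribution P Y]_y (expR (delta * y))%:E).
  by rewrite ge0_integral_distribution.
rewrite -(ge0_integral_weighted_pushforward (@measurable_id _ _ _) md d0 mE mexp exp0).
transitivity (\int[nu]_y ((expR (b (eta + delta) - b eta))%:E
    * (glm_density b k (eta + delta) y)%:E)).
  apply: eq_integral => y _; rewrite /= -!EFinM -!expRD; congr (expR _)%:E; ring.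
rewrite ge0_integralZl //.
- by rewrite family_density mule1.
- by apply/measurable_EFinP; exact: measurable_glm_density.
- by move=> y _; rewrite lee_fin; exact: expR_ge0.
Qed.

(** From the two exponential moments of order one, as |y| <= exp y + exp (- y). *)
Lemma glm_integrable (Y : {RV P >-> R}) eta : has_glm_law Y eta ->
  P.-integrable setT (fun w => (Y w)%:E).
Proof.
move=> Y_law; apply/integrableP; split; first exact/measurable_EFinP.
have me (c : R) : measurable_fun setT (fun w => (expR (c * Y w))%:E).
  apply/measurable_EFinP; apply: measurableT_comp => //; exact: measurable_funM.
apply: (@le_lt_trans _ _ (\int[P]_w ((expR (1 * Y w))%:E + (expR (-1 * Y w))%:E))).
  apply: ge0_le_integral_lower => w; first by rewrite abse_ge0.
  rewrite -EFinD lee_fin mul1r mulN1r.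
  have h (x : R) : (x <= expR x)%R.
    by have := expR_ge1Dx x; lra.
  have h1 := expR_ge0 (Y w); have h2 := expR_ge0 (- Y w).
  case: (ger0P (Y w)) => _.
    by apply: (le_trans (h _)); rewrite lerDl.
  by apply: (le_trans (h _)); rewrite lerDr.
rewrite ge0_integralD //; try by move=> w _; rewrite lee_fin expR_ge0.
by rewrite !(glm_mgf _ Y_law) -EFinD ltry.
Qed.

Variables (n : nat) (Y : 'I_n -> {RV P >-> R}) (eta : 'I_n -> R).
Hypothesis Y_indep : mutually_independent Y.
Hypothesis Y_law : forall i, has_glm_law (Y i) (eta i).

Lemma glm_joint_mgf (delta : 'I_n -> R) :
  \int[P]_w (expR (\sum_i delta i * Y i w))%:E
    = (expR (\sum_i (b (eta i + delta i) - b (eta i))))%:E.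
Proof.
rewrite expR_sum -(@integral_prod_indep _ _ _ P n Y Y_indep
  (fun i y => expR (delta i * y))).
- by apply: eq_integral => w _; rewrite expR_sum.
- by move=> i; apply: measurableT_comp => //; exact: measurable_funM.
- by move=> i y; exact: expR_ge0.
- by move=> i; exact: glm_mgf.
Qed.

End ExponentialFamily.

(** * The log-partition function *)

Section LogPartition.
Context {R : realType}.

(** Taylor's formula with the Lagrange remainder, of order two and in both
    directions: the mean value theorem for the remainder at a moving base
    point, corrected by the square that makes it vanish at both ends. *)
Lemma taylor_lagrange2 (f f1 f2 : R -> R) (x d : R) :
  (forall t : R, is_derive t 1 f (f1 t)) -> (forall t : R, is_derive t 1 f1 (f2 t)) ->
  exists2 c, `|c - x| <= `|d| & f (x + d) - f x - f1 x * d = f2 c * d ^+ 2 / 2.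
Proof.
move=> df df1; have [->|d0] := eqVneq d 0.
  by exists x; rewrite ?subrr ?normr0 // addr0 expr0n /=; ring.
pose y := x + d; pose K := (f y - f x - f1 x * d) / d ^+ 2.
pose F : R -> R := cst (f y) - f - f1 * (cst y - id) - cst K * (cst y - id) ^+ 2.
have FE t : F t = f y - f t - f1 t * (y - t) - K * (y - t) ^+ 2 by [].
have dF (t : R) : is_derive t 1 F ((2 * K - f2 t) * (y - t)).
  apply: is_derive_eq; rewrite /GRing.scale /= /cst /=.
  by rewrite !fctE /= /cst; ring.
have Fx : F x = 0.
  by rewrite FE /K /y; field.
have Fy : F y = 0 by rewrite FE subrr; ring.
have cF (i : interval R) : {within [set` i], continuous F}.
  by apply: derivable_within_continuous => t _; exact: ex_derive.
have key c : (2 * K - f2 c) * (y - c) = 0 -> c != y ->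
    f (x + d) - f x - f1 x * d = f2 c * d ^+ 2 / 2.
  move=> /eqP; rewrite mulf_eq0 => /orP[/eqP h|/eqP h] cy; last first.
    by move: cy; rewrite (_ : c = y) ?eqxx //; lra.
  have -> : f2 c = 2 * K by lra.
  by rewrite /K -/y; field.
have [dgt|dle] := ltP 0 d.
  have xy : x < y by rewrite /y ltrDl.
  have [c cI] := MVT xy (fun t _ => dF t) (cF _).
  rewrite Fx Fy subrr => /esym/eqP; rewrite mulf_eq0 => /orP[/eqP h|]; last first.
    by rewrite subr_eq0 gt_eqF.
  move: cI; rewrite in_itv /= => /andP[c1 c2].
  exists c; last by apply: key => //; rewrite lt_eqF.
  by rewrite !ger0_norm ?ltW //; move: c2; rewrite /y; lra.
have dlt : d < 0 by rewrite lt_neqAle d0.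
have xy : y < x by rewrite /y; lra.
have [c cI] := MVT xy (fun t _ => dF t) (cF _).
rewrite Fx Fy subrr => /esym/eqP; rewrite mulf_eq0 => /orP[/eqP h|]; last first.
  by rewrite subr_eq0 gt_eqF.
move: cI; rewrite in_itv /= => /andP[c1 c2].
exists c; last by apply: key => //; rewrite gt_eqF.
rewrite !ler0_norm ?ltW //; last by lra.
by move: c1; rewrite /y; lra.
Qed.

Variables (b : R -> R) (Cdev : R).
Hypothesis b_conv : strictly_convex b.
Hypothesis b_diff :
  forall (j : nat) (x : R), (j < 3)%N -> derivable (derive1n j b) x 1.
Hypothesis Cdev_ge1 : 1 <= Cdev.
Hypothesis b_dev :
  forall x y : R, `|y| <= 2^-1 -> derive1n 2 b (x + y) <= Cdev * derive1n 2 b x.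

Local Notation b1 := (derive1n 1 b).
Local Notation b2 := (derive1n 2 b).

(** The Bregman divergence of [b] between [x + d] and [x]: what one observation
    loses in log-likelihood beyond the linear term when its natural parameter
    moves by [d]. *)
Definition bregman (x d : R) : R := b (x + d) - b x - b1 x * d.

Lemma bregman_lagrange (x d : R) :
  exists2 c, `|c - x| <= `|d| & bregman x d = b2 c * d ^+ 2 / 2.
Proof.
apply: taylor_lagrange2 => t.
  by have /derivableP := @b_diff 0 t isT; rewrite -derive1E.
by have /derivableP := @b_diff 1 t isT; rewrite -derive1E.
Qed.

(** A negative value of the second derivative would, by [b_dev], persist on a whole
    interval, where [b] would be concave. *)
Lemma b2_ge0 x : 0 <= b2 x.
Proof.
rewrite leNgt; apply/negP => b2x.
have h d : `|d| <= 2^-1 -> d != 0 -> bregman x d < 0.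
  move=> dl d0; have [c cx ->] := bregman_lagrange x d.
  have : b2 c < 0.
    have := b_dev x (le_trans cx dl); rewrite addrC subrK => /le_lt_trans; apply.
    by rewrite pmulr_rlt0 // (lt_le_trans _ Cdev_ge1).
  have d2 : 0 < d ^+ 2 by rewrite exprn_even_gt0.
  by move=> c0; rewrite pmulr_llt0 // pmulr_llt0.
have n2 : `|2^-1 : R| <= 2^-1 by rewrite ger0_norm.
have nn2 : `|- 2^-1 : R| <= 2^-1 by rewrite normrN.
have := h _ n2 _; have := h _ nn2 _; rewrite oppr_eq0 invr_eq0 pnatr_eq0 => /(_ isT) h1 /(_ isT) h2.
have t01 : 0 < (2^-1 : R) < 1 by apply/andP; split; lra.
have ne : x + 2^-1 != x - 2^-1 by apply/eqP => h'; lra.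
have := b_conv ne t01.
rewrite (_ : 2^-1 * (x + 2^-1) + (1 - 2^-1) * (x - 2^-1) = x); last by field.
by move: h1 h2; rewrite /bregman => h1 h2; lra.
Qed.

(** The intermediate point of Taylor's formula is within one half of [x], so [b_dev]
    compares the second derivatives there; exchanging the two points gives the
    opposite bound. *)
Lemma bregman_le x d : `|d| <= 2^-1 -> bregman x d <= Cdev * b2 x * d ^+ 2 / 2.
Proof.
move=> dl; have [c cx ->] := bregman_lagrange x d.
have := b_dev x (le_trans cx dl); rewrite addrC subrK => h.
by rewrite ler_pM2r // ler_wpM2r // sqr_ge0.
Qed.

Lemma bregman_ge x d : `|d| <= 2^-1 -> b2 x * d ^+ 2 / (2 * Cdev) <= bregman x d.
Proof.
move=> dl; have [c cx ->] := bregman_lagrange x d.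
have C0 : 0 < Cdev by rewrite (lt_le_trans _ Cdev_ge1).
have xc : `|x - c| <= 2^-1 by rewrite distrC (le_trans cx dl).
have := b_dev c xc; rewrite addrC subrK => h.
have e : b2 x * d ^+ 2 / (2 * Cdev) = (b2 x / Cdev) * d ^+ 2 / 2.
  by rewrite invfM; move: (2^-1) (Cdev^-1) => h2 hC; ring.
rewrite [leLHS]e.
rewrite ler_pM2r // ler_wpM2r ?sqr_ge0 //.
by rewrite ler_pdivrMr // mulrC.
Qed.

Lemma b_chord_le (x d t : R) : 0 < t < 1 ->
  b (x + t * d) <= (1 - t) * b x + t * b (x + d).
Proof.
move=> t01; have [->|d0] := eqVneq d 0; first by rewrite mulr0 !addr0; lra.
have ne : x + d != x by rewrite -subr_eq0 addrAC subrr add0r.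
have := ltW (b_conv ne t01).
by rewrite (_ : t * (x + d) + (1 - t) * x = x + t * d); [lra|ring].
Qed.

End LogPartition.

(** * Log-likelihoods and their maximizers *)

Lemma cauchy_schwarz_sum {R : realType} (I : finType) (a c : I -> R) :
  (\sum_i a i * c i) ^+ 2 <= (\sum_i a i ^+ 2) * (\sum_i c i ^+ 2).
Proof.
set ac := \sum_i _; set aa := \sum_i _; set cc := \sum_i _.
have cc_ge0 : 0 <= cc by apply: sumr_ge0 => i _; exact: sqr_ge0.
have : 0 <= \sum_i (cc * a i - ac * c i) ^+ 2 by apply: sumr_ge0 => i _; exact: sqr_ge0.
have -> : \sum_i (cc * a i - ac * c i) ^+ 2 = cc * (aa * cc - ac ^+ 2).
  rewrite (eq_bigr (fun i => cc ^+ 2 * a i ^+ 2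
      + (- (2 * cc * ac)) * (a i * c i) + ac ^+ 2 * c i ^+ 2)) => [|i _]; last by ring.
  rewrite !big_split /= -!mulr_sumr -/aa -/ac -/cc; ring.
have [cc0|ccn0] := eqVneq cc 0.
  move=> _; suff -> : ac = 0 by rewrite expr0n /= mulr_ge0 // sumr_ge0 // => i _; exact: sqr_ge0.
  rewrite /ac big1 // => i _; suff -> : c i = 0 by rewrite mulr0.
  move/eqP: cc0; rewrite psumr_eq0 => [/allP/(_ i (mem_index_enum _))|j _]; last exact: sqr_ge0.
  by rewrite sqrf_eq0 => /eqP.
by rewrite pmulr_rge0 ?subr_ge0 // lt_def ccn0.
Qed.

Section Likelihood.
Context {R : realType}.
Variables (b k : R -> R) (Cdev : R).
Hypothesis b_conv : strictly_convex b.
Hypothesis b_diff :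
  forall (j : nat) (x : R), (j < 3)%N -> derivable (derive1n j b) x 1.
Hypothesis Cdev_ge1 : 1 <= Cdev.
Hypothesis b_dev :
  forall x y : R, `|y| <= 2^-1 -> derive1n 2 b (x + y) <= Cdev * derive1n 2 b x.
Variables (n d : nat) (Z : 'M[R]_(n, d)).

Local Notation b1 := (derive1n 1 b).
Local Notation b2 := (derive1n 2 b).
Local Notation eta t i := ((Z *m t) i 0).

Let Cdev_gt0 : 0 < Cdev. Proof. exact: lt_le_trans Cdev_ge1. Qed.

Lemma mulmxZ_entry (a : R) (u : 'cV[R]_d) i : (Z *m (a *: u)) i 0 = a * (Z *m u) i 0.
Proof. by rewrite -scalemxAr mxE. Qed.

Lemma qform_fisher (t v : 'cV[R]_d) :
  qform (fisher b Z t) v = \sum_i b2 (eta t i) * (Z *m v) i 0 ^+ 2.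
Proof.
rewrite /qform /fisher mulmx_sumr mulmx_suml summxE; apply: eq_bigr => i _.
rewrite -scalemxAr -scalemxAl mxE; congr (_ * _).
have -> : v^T *m ((row i Z)^T *m row i Z) *m v = (row i Z *m v)^T *m (row i Z *m v).
  by rewrite trmx_mul !mulmxA.
by rewrite -row_mul mxE big_ord1 !mxE expr2.
Qed.

Lemma fisher_psd (t : 'cV[R]_d) : psdmx (fisher b Z t).
Proof.
split=> [|v].
  rewrite /fisher linear_sum; apply: eq_bigr => i _.
  by rewrite linearZ /= trmx_mul trmxK.
rewrite qform_fisher sumr_ge0 // => i _.
by rewrite mulr_ge0 ?sqr_ge0 // (b2_ge0 b_conv b_diff Cdev_ge1 b_dev).
Qed.

Variable y : 'I_n -> R.

Definition score (t u : 'cV[R]_d) : R :=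
  \sum_i (y i - b1 (eta t i)) * (Z *m u) i 0.

Lemma loglik_expand (t u : 'cV[R]_d) :
  loglik b k Z y (t + u) - loglik b k Z y t
    = score t u - \sum_i bregman b (eta t i) ((Z *m u) i 0).
Proof.
rewrite /loglik /score -!sumrB; apply: eq_bigr => i _.
by rewrite mulmxDr mxE /bregman; ring.
Qed.

Lemma loglik_concave (t u : 'cV[R]_d) (a : R) : 0 < a < 1 ->
  (1 - a) * loglik b k Z y t + a * loglik b k Z y (t + u)
    <= loglik b k Z y (t + a *: u).
Proof.
move=> a01; rewrite /loglik !mulr_sumr -big_split /=; apply: ler_sum => i _.
have := b_chord_le b_conv (eta t i) ((Z *m u) i 0) a01.
by rewrite !mulmxDr -scalemxAr !mxE; nra.
Qed.

(** At a maximizer the score vanishes; only that it is nonnegative in the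
    direction [u] matters, and this follows by going slightly backwards. *)
Lemma mle_score_ge0 (t u : 'cV[R]_d) : is_mle b k Z y t ->
  (forall i, `|(Z *m u) i 0| <= 2^-1) -> 0 <= score t u.
Proof.
move=> tmle small; rewrite leNgt; apply/negP => A0; set A := score t u in A0.
pose Q := Cdev * qform (fisher b Z t) u / 2.
have Q0 : 0 <= Q.
  by rewrite divr_ge0 // mulr_ge0 ?(ltW Cdev_gt0) // (fisher_psd t).2.
(* small enough for the linear gain [- e * A] to beat the quadratic loss [e ^+ 2 * Q] *)
pose e := - A / (- A + Q + 1).
have den0 : 0 < - A + Q + 1 by lra.
have e0 : 0 < e by rewrite divr_gt0 // oppr_gt0.
have e1 : e <= 1 by rewrite ler_pdivrMr // mul1r; lra.
have := tmle (t + - e *: u); rewrite -subr_le0 loglik_expand.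
have -> : score t (- e *: u) = - e * A.
  rewrite /A /score mulr_sumr; apply: eq_bigr => i _.
  by rewrite mulmxZ_entry; ring.
have : \sum_i bregman b (eta t i) ((Z *m (- e *: u)) i 0) <= e ^+ 2 * Q.
  rewrite /Q qform_fisher mulr_sumr mulr_suml mulr_sumr; apply: ler_sum => i _.
  rewrite mulmxZ_entry.
  have es : `|- e * (Z *m u) i 0| <= 2^-1.
    rewrite normrM normrN (gtr0_norm e0) (le_trans _ (small i)) //.
    by rewrite ler_piMl.
  apply: le_trans (bregman_le b_diff b_dev (eta t i) es) _.
  suff -> : Cdev * b2 (eta t i) * (- e * (Z *m u) i 0) ^+ 2 / 2
      = e ^+ 2 * (Cdev * (b2 (eta t i) * (Z *m u) i 0 ^+ 2) / 2) by [].
  by ring.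
have eQ : e * Q < - A.
  by rewrite /e mulrAC ltr_pdivrMr //; nra.
by nra.
Qed.

Lemma mle_gap_ge (t u : 'cV[R]_d) : is_mle b k Z y t ->
  (forall i, `|(Z *m u) i 0| <= 2^-1) ->
  - (Cdev * qform (fisher b Z t) u / 2) <= loglik b k Z y (t + u) - loglik b k Z y t.
Proof.
move=> tmle small; rewrite loglik_expand.
have := mle_score_ge0 tmle small.
suff : \sum_i bregman b (eta t i) ((Z *m u) i 0)
    <= Cdev * qform (fisher b Z t) u / 2 by lra.
rewrite qform_fisher mulr_sumr mulr_suml; apply: ler_sum => i _.
apply: le_trans (bregman_le b_diff b_dev (eta t i) (small i)) _.
by rewrite mulrA.
Qed.

(** If the maximizer were outside the ellipsoid, concavity would make the
    likelihood at the point where the segment from [t0] leaves the ellipsoid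
    at least that at [t0], while there the quadratic loss already exceeds what
    the score can gain. *)
Lemma mle_localized (t0 t : 'cV[R]_d) (z s r : R) :
  is_mle b k Z y t -> 0 < r -> z * r <= 2^-1 -> 2 * Cdev * s < r ->
  (forall u i, `|(Z *m u) i 0| <= z * Num.sqrt (qform (fisher b Z t0) u)) ->
  (forall u, score t0 u <= s * Num.sqrt (qform (fisher b Z t0) u)) ->
  Num.sqrt (qform (fisher b Z t0) (t - t0)) <= r.
Proof.
move=> tmle r0 zr sr hz hs; rewrite leNgt; apply/negP.
set q := Num.sqrt _ => rq.
have q0 : 0 < q by exact: lt_trans rq.
pose a := r / q; pose u := a *: (t - t0).
have a01 : 0 < a < 1 by rewrite divr_gt0 //= ltr_pdivrMr // mul1r.
have a0 : 0 <= a by case/andP: a01 => /ltW.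
have qu : Num.sqrt (qform (fisher b Z t0) u) = r.
  rewrite /u /qform -scalemxAr linearZ /= -!scalemxAl mxE mxE mulrA -expr2.
  rewrite sqrtrM ?sqr_ge0 // sqrtr_sqr ger0_norm // -/(qform _ _) -/q.
  by rewrite /a divfK // gt_eqF.
have small i : `|(Z *m u) i 0| <= 2^-1.
  by apply: le_trans (hz u i) _; rewrite qu.
have gain : loglik b k Z y t0 <= loglik b k Z y (t0 + u).
  have := loglik_concave t0 (t - t0) a01; rewrite -/u.
  rewrite [t0 + (t - t0)]addrC subrK; have := tmle t0; nra.
have := loglik_expand t0 u.
have : r ^+ 2 / (2 * Cdev) <= \sum_i bregman b (eta t0 i) ((Z *m u) i 0).
  rewrite -{1}qu sqr_sqrtr ?(fisher_psd t0).2 //.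
  rewrite qform_fisher mulr_suml; apply: ler_sum => i _.
  exact: bregman_ge.
have := hs u; rewrite qu => h1 h2 h3.
have : s * r < r ^+ 2 / (2 * Cdev).
  rewrite ltr_pdivlMr; last by rewrite mulr_gt0.
  rewrite -subr_gt0 (_ : _ - _ = r * (r - 2 * Cdev * s)); last by ring.
  by rewrite mulr_gt0 // subr_gt0.
by lra.
Qed.

Lemma fisher_qform_le (t0 t v : 'cV[R]_d) :
  (forall i, `|(Z *m (t - t0)) i 0| <= 2^-1) ->
  qform (fisher b Z t0) v <= Cdev * qform (fisher b Z t) v.
Proof.
move=> small; rewrite [leLHS]qform_fisher [X in _ <= _ * X]qform_fisher [leRHS]mulr_sumr.
apply: ler_sum => i _.
rewrite [leRHS]mulrA; apply: ler_wpM2r; first exact: sqr_ge0.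
have h : `|eta t0 i - eta t i| <= 2^-1.
  by have := small i; rewrite mulmxBr !mxE distrC.
by have := b_dev (eta t i) h; rewrite addrC subrK.
Qed.

End Likelihood.

(** * Standardization by the Fisher information *)

Section Standardization.
Context {R : realType}.
Variables (b : R -> R) (n d : nat) (Z : 'M[R]_(n, d)) (t0 : 'cV[R]_d).

Local Notation b1 := (derive1n 1 b).
Local Notation b2 := (derive1n 2 b).
Let F := fisher b Z t0.
Hypothesis F_psd : psdmx F.
Hypothesis F_unit : F \in unitmx.

(** The design with the columns decorrelated by the Fisher information. *)
Definition std_design : 'M[R]_(n, d) := Z *m invmx (sqrtmx F).

Local Notation C := std_design.
Let B := sqrtmx F.

Let BB : B *m B = F. Proof. by have [] := sqrtmxP F_psd. Qed.
Let sB : B^T = B. Proof. by have [[]] := sqrtmxP F_psd. Qed.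

Let B_unit : B \in unitmx.
Proof. by move: F_unit; rewrite -BB unitmx_mul => /andP[]. Qed.

Let CB : C *m B = Z. Proof. by rewrite mulmxKV. Qed.

Lemma std_design_norm i :
  l2norm (invmx (sqrtmx F) *m (row i Z)^T) ^+ 2 = \sum_j C i j ^+ 2.
Proof.
rewrite l2norm_sqr; apply: eq_bigr => j _; congr (_ ^+ 2).
rewrite -/B -{1}sB -trmx_inv -trmx_mul mxE -row_mul mxE.
by rewrite /std_design -/B.
Qed.

Lemma sqrt_qformE u : Num.sqrt (qform F u) = l2norm (B *m u).
Proof.
by rewrite qform_sqrtmx // sqrtr_sqr ger0_norm // sqrtr_ge0.
Qed.

Lemma design_entry_le u i :
  `|(Z *m u) i 0| <= l2norm (invmx (sqrtmx F) *m (row i Z)^T) * Num.sqrt (qform F u).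
Proof.
rewrite sqrt_qformE -(ler_pXn2r (n := 2)) ?nnegrE ?mulr_ge0 ?sqrtr_ge0 //.
rewrite real_normK ?num_real // exprMn std_design_norm l2norm_sqr.
by rewrite -CB -mulmxA mxE; exact: cauchy_schwarz_sum.
Qed.

Lemma std_design_info j : \sum_i b2 ((Z *m t0) i 0) * C i j ^+ 2 = 1.
Proof.
have := qform_fisher b Z t0 (invmx B *m delta_mx j 0).
rewrite -/F qform_sqrtmx // -/B mulKVmx // l2norm_sqr.
rewrite (bigD1 j) //= big1 => [|i /negPf ij]; last by rewrite mxE ij expr0n.
rewrite mxE !eqxx expr1n addr0 => ->; apply: eq_bigr => i _.
by congr (_ * _ ^+ 2); rewrite mulmxA -colE [RHS]mxE.
Qed.

Definition std_score (y : 'I_n -> R) (j : 'I_d) : R :=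
  \sum_i C i j * (y i - b1 ((Z *m t0) i 0)).

Lemma score_le (y : 'I_n -> R) (s : R) u : 0 <= s ->
  (forall j, `|std_score y j| <= s) ->
  score b Z y t0 u <= Num.sqrt d%:R * s * Num.sqrt (qform F u).
Proof.
move=> s0 hs.
have -> : score b Z y t0 u = \sum_j std_score y j * (B *m u) j 0.
  have h i : (Z *m u) i 0 = \sum_j C i j * (B *m u) j 0.
    by rewrite -{1}CB -mulmxA mxE.
  rewrite /score /std_score.
  under eq_bigr => i _ do rewrite h mulr_sumr.
  rewrite exchange_big /=; apply: eq_bigr => j _; rewrite mulr_suml.
  by apply: eq_bigr => i _; ring.
apply: le_trans (ler_norm _) _.
rewrite -(ler_pXn2r (n := 2)) ?nnegrE ?mulr_ge0 ?sqrtr_ge0 //.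
rewrite real_normK ?num_real //; apply: le_trans (cauchy_schwarz_sum _ _) _.
rewrite sqrt_qformE !exprMn l2norm_sqr ler_wpM2r ?sum_sqr_ge0 //.
rewrite sqr_sqrtr ?ler0n // mulr_natl.
apply: (@le_trans _ _ (\sum_(j < d) s ^+ 2)); last by rewrite sumr_const card_ord.
apply: ler_sum => j _; rewrite -(real_normK (num_real (std_score y j))).
by rewrite ler_pXn2r ?nnegrE.
Qed.

End Standardization.

(** * Likelihood ratios and scores under the true law *)

Section ModelProbability.
Context {R : realType} {dsp : measure_display} {Omega : measurableType dsp}.
Variables (nu : {sigma_finite_measure set R -> \bar R}) (b k : R -> R) (Cdev : R).
Hypothesis k_meas : measurable_fun setT k.
Hypothesis b_conv : strictly_convex b.
Hypothesis b_diff :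
  forall (j : nat) (x : R), (j < 3)%N -> derivable (derive1n j b) x 1.
Hypothesis family_density : forall eta : R,
  (\int[nu]_y (glm_density b k eta y)%:E)%E = 1%E.
Hypothesis Cdev_ge1 : 1 <= Cdev.
Hypothesis b_dev :
  forall x y : R, `|y| <= 2^-1 -> derive1n 2 b (x + y) <= Cdev * derive1n 2 b x.
Variables (P : probability Omega R) (n : nat) (Y : 'I_n -> {RV P >-> R}).
Hypothesis Y_indep : mutually_independent Y.
Hypothesis kY_int :
  forall i, P.-integrable setT (fun omega => (k (Y i omega))%:E).
Variables (d : nat) (Z : 'M[R]_(n, d)) (t0 : 'cV[R]_d).
Hypothesis Y_law : forall i, has_glm_law nu b k (Y i) ((Z *m t0) i 0).

Local Notation b1 := (derive1n 1 b).
Local Notation b2 := (derive1n 2 b).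
Local Notation eta i := ((Z *m t0) i 0).
Local Notation "'lik' t" := (fun w => loglik b k Z (fun i => Y i w) t)
  (at level 10, t at level 8).

Let joint_mgf (delta : 'I_n -> R) :
  (\int[P]_w (expR (\sum_i delta i * Y i w))%:E
    = (expR (\sum_i (b (eta i + delta i) - b (eta i))))%:E)%E.
Proof. exact: (glm_joint_mgf k_meas family_density Y_indep Y_law). Qed.

Lemma measurable_linear_stat (c : 'I_n -> R) (a : R) :
  measurable_fun setT (fun w => \sum_i c i * Y i w + a).
Proof.
apply: measurable_funD => //; apply: measurable_sum => i.
exact: measurable_funM.
Qed.

Lemma integral_exp_affine (delta : 'I_n -> R) (a : R) :
  (\int[P]_w (expR (\sum_i delta i * Y i w + a))%:E
    = (expR (\sum_i (b (eta i + delta i) - b (eta i)) + a))%:E)%E.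
Proof.
rewrite [in RHS]expRD [in RHS]EFinM.
rewrite -joint_mgf muleC.
rewrite -ge0_integralZl //.
- by apply: eq_integral => w _; rewrite expRD mulrC EFinM.
- apply/measurable_EFinP; apply: measurableT_comp => //.
  rewrite (_ : (fun w => _) = fun w => \sum_i delta i * Y i w + 0).
    exact: measurable_linear_stat.
  by apply/funext => w; rewrite addr0.
Qed.

(** Chernoff's bound with exponent [s]: the cumulants are Bregman divergences, and
    these are quadratic because [s * c i] stays below one half. *)
Lemma score_stat_tail (c : 'I_n -> R) (s z : R) :
  (forall i, `|c i| <= z) -> 0 <= s -> s * z <= 2^-1 ->
  \sum_i b2 (eta i) * c i ^+ 2 = 1 ->
  (P [set w : Omega | (Cdev * s <= \sum_i c i * (Y i w - b1 (eta i)))%R]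
     <= (expR (- (Cdev * s ^+ 2 / 2)))%:E)%E.
Proof.
move=> cz s0 sz c1; set A := [set w : Omega | _].
pose a := - (s * \sum_i c i * b1 (eta i)) - Cdev * s ^+ 2.
have aE w : \sum_i (s * c i) * Y i w + a
    = s * (\sum_i c i * (Y i w - b1 (eta i))) - Cdev * s ^+ 2.
  rewrite /a addrA !mulr_sumr -sumrB; congr (_ - _); apply: eq_bigr => i _; ring.
have cE w : \sum_i c i * Y i w + (- (\sum_i c i * b1 (eta i)) - Cdev * s)
    = \sum_i c i * (Y i w - b1 (eta i)) - Cdev * s.
  rewrite addrA -sumrB; congr (_ - _); apply: eq_bigr => i _; ring.
have mA : measurable A.
  rewrite /A (_ : [set w | _] = [set w | 0 <= \sum_i c i * Y i w +
      (- (\sum_i c i * b1 (eta i)) - Cdev * s)]).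
    rewrite -[X in measurable X]setTI.
    by apply: measurable_fun_le => //; exact: measurable_linear_stat.
  by apply/seteqP; split => w /=; rewrite cE subr_ge0.
rewrite -[A]setIT -integral_indic //.
apply: (@le_trans _ _ (\int[P]_w (expR (\sum_i (s * c i) * Y i w + a))%:E)%E).
  apply: ge0_le_integral_lower => w; first by rewrite lee_fin.
  rewrite lee_fin aE indicE; case: (boolP (w \in A)) => [|_]; last exact: expR_ge0.
  rewrite inE /A /= => h; rewrite -[X in X <= _]expR0 ler_expR.
  by rewrite subr_ge0 expr2 mulrA [Cdev * s]mulrC -mulrA ler_wpM2l.
rewrite integral_exp_affine lee_fin ler_expR /a.
have : \sum_i bregman b (eta i) (s * c i) <= Cdev * s ^+ 2 / 2.
  have -> : Cdev * s ^+ 2 / 2 = \sum_i Cdev * s ^+ 2 / 2 * (b2 (eta i) * c i ^+ 2).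
    by rewrite -mulr_sumr c1 mulr1.
  apply: ler_sum => i _.
  have sc : `|s * c i| <= 2^-1.
    by rewrite normrM ger0_norm // (le_trans _ sz) // ler_wpM2l.
  apply: le_trans (bregman_le b_diff b_dev (eta i) sc) _.
  suff -> : Cdev * b2 (eta i) * (s * c i) ^+ 2 / 2
     = Cdev * s ^+ 2 / 2 * (b2 (eta i) * c i ^+ 2) by [].
  by ring.
have -> : \sum_i bregman b (eta i) (s * c i)
    = \sum_i (b (eta i + s * c i) - b (eta i)) - s * \sum_i c i * b1 (eta i).
  rewrite mulr_sumr -sumrB; apply: eq_bigr => i _; rewrite /bregman; ring.
lra.
Qed.

(** The fractional likelihood ratio is the likelihood ratio of an interior
    point of the segment of natural parameters, deflated by convexity. *)
Lemma fractional_likelihood_le1 (alpha : R) (t : 'cV[R]_d) : 0 < alpha < 1 ->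
  (\int[P]_w (expR (alpha * (lik t w - lik t0 w)))%:E <= 1)%E.
Proof.
move=> a01; pose delta i := alpha * ((Z *m t) i 0 - eta i).
pose a := - \sum_i alpha * (b ((Z *m t) i 0) - b (eta i)).
rewrite (eq_integral (fun w => (expR (\sum_i delta i * Y i w + a))%:E)); last first.
  move=> w _; congr (expR _)%:E; rewrite /loglik -sumrB mulr_sumr /a -sumrB.
  by apply: eq_bigr => i _; rewrite /delta; ring.
rewrite integral_exp_affine lee_fin -expR0 ler_expR /a -sumrB.
apply: sumr_le0 => i _.
have := b_chord_le b_conv (eta i) ((Z *m t) i 0 - eta i) a01.
rewrite -/(delta i) [eta i + (_ - _)]addrC subrK.
by lra.
Qed.

Lemma likelihood_ratio_mean1 (t : 'cV[R]_d) :
  (\int[P]_w (expR (lik t w - lik t0 w))%:E = 1)%E.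
Proof.
pose delta i := (Z *m t) i 0 - eta i.
pose a := - \sum_i (b ((Z *m t) i 0) - b (eta i)).
rewrite (eq_integral (fun w => (expR (\sum_i delta i * Y i w + a))%:E)); last first.
  move=> w _; congr (expR _)%:E; rewrite /loglik -sumrB /a -sumrB.
  by apply: eq_bigr => i _; rewrite /delta; ring.
rewrite integral_exp_affine /a -sumrB big1 ?expR0 // => i _.
by rewrite /delta [eta i + _]addrC subrK subrr.
Qed.

Lemma loglik_integrable (t : 'cV[R]_d) : P.-integrable setT (EFin \o lik t).
Proof.
have h i : P.-integrable setT (fun w => ((Z *m t) i 0)%:E * (Y i w)%:E
    + (k (Y i w))%:E + (- b ((Z *m t) i 0))%:E)%E.
  have h1 := integrableZl measurableT ((Z *m t) i 0)
    (glm_integrable k_meas family_density (Y_law i)).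
  have h3 := finite_measure_integrable_cst P (- b ((Z *m t) i 0)) measurableT.
  have h12 := integrableD measurableT h1 (kY_int i).
  by have := integrableD measurableT h12 h3.
have := integrable_sum measurableT (index_enum 'I_n) (P := xpredT) (fun i _ => h i).
apply: eq_integrable => // w _ /=.
rewrite /loglik -sumEFin; apply: eq_bigr => i _.
by rewrite -EFinM -!EFinD; congr EFin; ring.
Qed.

Let fine_P_setT : fine ((P : {measure set Omega -> \bar R}) setT) = 1.
Proof. exact: (congr1 fine (probability_setT P)). Qed.

Let elik t : R := (\int[P]_w lik t w)%R.

Let elikE t : ('E_P[lik t] = (elik t)%:E)%E.
Proof.
rewrite expectation.unlock /elik /Rintegral fineK //.
exact: (integrable_fin_num measurableT (loglik_integrable t)).
Qed.

(** Gibbs' inequality, from log x <= x - 1 at the likelihood ratio. *)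
Let elik_le t : elik t <= elik t0.
Proof.
rewrite -subr_le0 /elik -RintegralB //; try exact: loglik_integrable.
pose g w := expR (lik t w - lik t0 w).
have gint : P.-integrable setT (EFin \o g).
  apply/integrableP; split.
    apply/measurable_EFinP; apply: measurableT_comp => //.
    have /integrableP[/measurable_EFinP m1 _] := loglik_integrable t.
    have /integrableP[/measurable_EFinP m2 _] := loglik_integrable t0.
    exact: measurable_funB.
  rewrite (eq_integral (fun w => (g w)%:E)) ?likelihood_ratio_mean1 ?ltry //.
  by move=> w _; rewrite /= ger0_norm // expR_ge0.
have cint : P.-integrable setT (EFin \o cst (1 : R)).
  exact: finite_measure_integrable_cst.
apply: (@le_trans _ _ (\int[P]_w (g w - cst 1 w))).
  apply: le_Rintegral => //.
  - by have := integrableB measurableT (loglik_integrable t) (loglik_integrable t0).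
  - by have := integrableB measurableT gint cint.
  - by move=> w _; rewrite /g /=; have := expR_ge1Dx (lik t w - lik t0 w); lra.
rewrite RintegralB // Rintegral_cst // fine_P_setT /Rintegral.
by rewrite likelihood_ratio_mean1 /= mulr1 subrr.
Qed.

(** The true parameter maximizes the expected log-likelihood by Gibbs'
    inequality, and a second maximizer would have to give the same linear
    predictors: at the midpoint of the two, strict convexity of [b] gains a
    deterministic amount. *)
Lemma theta_star_true : fisher b Z (theta_star b k Z Y) \in unitmx ->
  theta_star b k Z Y = t0.
Proof.
move=> Fu; set t := theta_star b k Z Y.
have tmax t' : elik t' <= elik t.
  have ex : exists t1, forall t', ('E_P[lik t'] <= 'E_P[lik t1])%E.
    by exists t0 => t1; rewrite !elikE lee_fin.
  by have := @xgetPex _ 0 [set t1 | forall t', ('E_P[lik t'] <= 'E_P[lik t1])%E] ex t';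
    rewrite !elikE lee_fin.
pose u := t - t0; pose m := t0 + 2^-1 *: u.
pose gap i := 2^-1 * b (eta i) + 2^-1 * b ((Z *m t) i 0) - b ((Z *m m) i 0).
have mE i : (Z *m m) i 0 = 2^-1 * ((Z *m t) i 0) + (1 - 2^-1) * eta i.
  by rewrite /m /u mulmxDr mxE mulmxZ_entry mulmxBr !mxE; field.
have gap0 i : 0 <= gap i ?= iff ((Z *m t) i 0 == eta i).
  rewrite /gap mE; have [->|ne] := eqVneq ((Z *m t) i 0) (eta i).
    rewrite (_ : 2^-1 * eta i + (1 - 2^-1) * eta i = eta i); last by field.
    by rewrite (_ : _ + _ - _ = 0); [exact/leif_refl|field].
  have t01 : 0 < (2^-1 : R) < 1 by apply/andP; split; lra.
  have := b_conv ne t01 => h; split; first by lra.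
  by apply/negbTE; rewrite lt_eqF //; lra.
have likm w : lik m w = 2^-1 * (lik t w + lik t0 w) + \sum_i gap i.
  rewrite /loglik -!big_split /= mulr_sumr -big_split /=; apply: eq_bigr => i _.
  by rewrite /gap mE; field.
have : elik m = 2^-1 * (elik t + elik t0) + \sum_i gap i.
  rewrite /elik; under eq_Rintegral => w _ do rewrite likm.
  have s1 : P.-integrable setT (EFin \o (fun w => lik t w + lik t0 w)).
    by have := integrableD measurableT (loglik_integrable t) (loglik_integrable t0).
  have s2 : P.-integrable setT (EFin \o (fun w => 2^-1 * (lik t w + lik t0 w))).
    by have := integrableZl measurableT 2^-1 s1.
  rewrite RintegralD //; last exact: finite_measure_integrable_cst.
  rewrite RintegralZl // RintegralD //; try exact: loglik_integrable.
  by rewrite Rintegral_cst // fine_P_setT mulr1.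
have := tmax m; have := elik_le m.
move=> h1 h2 h3.
have gs : \sum_i gap i <= 0 by lra.
have geq i : (Z *m t) i 0 = eta i.
  apply/eqP; rewrite -(gap0 i).2 eq_le (gap0 i).1 /=.
  rewrite (le_trans _ gs) // (bigD1 i) //= lerDl.
  by apply: sumr_ge0 => j _; exact: (gap0 j).1.
have pd := psd_unit_posdef (fisher_psd b_conv b_diff Cdev_ge1 b_dev Z t) Fu.
apply/eqP; rewrite -subr_eq0; apply: contraT => u0.
have := pd.2 _ u0; rewrite qform_fisher big1 ?ltxx // => i _.
have : (Z *m (t - t0)) i 0 = 0.
  by rewrite mulmxBr [LHS]mxE [X in _ + X]mxE geq subrr.
by move=> ->; rewrite expr0n mulr0.
Qed.

End ModelProbability.

(** * Submodels and slabs *)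

Section Submodels.
Context {R : realType}.
Variables (b k : R -> R) (n p : nat) (X : 'M[R]_(n, p)).

Lemma mulmx_extend (S : {set 'I_p}) (t : 'cV[R]_#|S|) :
  X *m extend t = cols X S *m t.
Proof.
apply/colP => i; rewrite !mxE.
under eq_bigr => j _ do rewrite mxE big_mkcond mulr_sumr.
rewrite exchange_big /=; apply: eq_bigr => l _.
rewrite (bigD1 (enum_val l)) //= eqxx big1 ?addr0 ?mxE // => j jl.
by rewrite eq_sym (negPf jl) mulr0.
Qed.

Lemma loglik_extend (S : {set 'I_p}) (y : 'I_n -> R) (t : 'cV[R]_#|S|) :
  loglik b k X y (extend t) = loglik b k (cols X S) y t.
Proof. by rewrite /loglik mulmx_extend. Qed.

Lemma supp_extend (S : {set 'I_p}) (t : 'cV[R]_#|S|) : supp (extend t) \subset S.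
Proof.
apply/fintype.subsetP => j; rewrite inE mxE; apply: contraR => jS.
rewrite big1 // => l /eqP lj; by move: jS; rewrite -lj enum_valP.
Qed.

Lemma extend_supp (theta : 'cV[R]_p) :
  extend (\col_(l < #|supp theta|) theta (enum_val l) 0) = theta.
Proof.
apply/colP => j; rewrite mxE; under eq_bigr => l _ do rewrite mxE.
have [jS|] := boolP (j \in supp theta); last first.
  move=> jS; have -> : theta j 0 = 0 by move: jS; rewrite inE negbK => /eqP.
  rewrite big1 // => l /eqP lj; by move: jS; rewrite -lj enum_valP.
rewrite (bigD1 (enum_rank_in jS j)) /= ?enum_rankK_in // big1 ?addr0 // => l.
move=> /andP[/eqP lj] /negP[]; apply/eqP.
by rewrite -[LHS](enum_valK_in jS); congr enum_rank_in.
Qed.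

End Submodels.

Section QuadraticForms.
Context {R : realType}.

Lemma qform_add_le m (A : 'M[R]_m) (u v : 'cV[R]_m) : psdmx A ->
  qform A (u + v) <= 2 * qform A u + 2 * qform A v.
Proof.
move=> pA; have := pA.2 (u - v).
suff : qform A (u + v) + qform A (u - v) = 2 * qform A u + 2 * qform A v by lra.
have tD (s t : 'cV[R]_m) : (s + t)^T = s^T + t^T by rewrite linearD.
have tN (s : 'cV[R]_m) : (- s)^T = - s^T by rewrite linearN.
rewrite /qform !(tD, tN) !(mulmxDl, mulmxDr, mulmxN, mulNmx) !opprK.
have eD (M N : 'M[R]_1) : (M + N) 0 0 = M 0 0 + N 0 0 by rewrite mxE.
have eN (M : 'M[R]_1) : (- M) 0 0 = - M 0 0 by rewrite mxE.
by rewrite !(eD, eN); ring.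
Qed.

Lemma sqrtr_exp (x : R) m : 0 <= x -> Num.sqrt (x ^+ m) = Num.sqrt x ^+ m.
Proof.
move=> x0; elim: m => [|m ih]; first by rewrite !expr0 sqrtr1.
by rewrite !exprS sqrtrM // ih.
Qed.

Lemma slab_eq n p (b k : R -> R) (X : 'M[R]_(n, p)) (lambda : R) (y : 'I_n -> R)
    (S : {set 'I_p}) (t : 'cV[R]_#|S|) :
  let m := mle b k (cols X S) y in let F := fisher b (cols X S) m in
  0 < lambda -> posdefmx F ->
  slab b k X lambda y t
    = Num.sqrt (\det (lambda *: F) / (2 * pi) ^+ #|S|)
      * expR (- (lambda * qform F (t - m) / 2)).
Proof.
move=> m F l0 pF; rewrite /slab -/m -/F /mvn_pdf invmxK qformZ; congr (_ * _).
have dF := det_posdef_gt0 (posdefmxZ l0 pF).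
have p0 : 0 < (2 * pi : R) ^+ #|S| by rewrite exprn_gt0 // mulr_gt0 // pi_gt0.
have di : \det (invmx (lambda *: F)) = (\det (lambda *: F))^-1.
  apply: (mulfI (lt0r_neq0 dF)); rewrite mulfV ?gt_eqF // -det_mulmx mulmxV ?det1 //.
  by rewrite unitmxE unitfE gt_eqF.
by rewrite di -sqrtrV ?divr_ge0 ?ltW // invf_div.
Qed.

End QuadraticForms.

Section SlabUpper.
Context {R : realType}.
Variables (n p : nat) (b k : R -> R) (X : 'M[R]_(n, p)) (lambda D L : R).
Variables (S : {set 'I_p}) (tb : 'cV[R]_#|S|).
Local Notation s := #|S|.
Local Notation Z := (cols X S).
Let Fbar := fisher b Z tb.
Hypothesis lambda_gt0 : 0 < lambda.
Hypothesis D_gt0 : 0 < D.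
Hypothesis Fbar_pd : posdefmx Fbar.

(** A data-free multiple of a Gaussian density that dominates the slab.  Its precision
    is smaller by a factor 2 D, of which D is lost on the estimated information and 2
    on moving the centre to [tb]; the exponential factor pays for the distance
    between the two centres. *)
Definition slab_bound (t : 'cV[R]_s) : R :=
  Num.sqrt (\det ((lambda * D) *: Fbar) / (2 * pi) ^+ s)
  * (expR (lambda * s%:R * L / 2)
     * expR (- (qform ((lambda / (2 * D)) *: Fbar) (t - tb) / 2))).

Lemma slab_bound_ge0 t : 0 <= slab_bound t.
Proof. by rewrite /slab_bound !mulr_ge0 ?sqrtr_ge0 ?expR_ge0. Qed.

(** The Loewner bounds control the normalising constant from above and the quadratic
    form from below. *)
Lemma slab_le_bound (y : 'I_n -> R) (t : 'cV[R]_s) :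
  let m := mle b k Z y in let F := fisher b Z m in
  psdmx F ->
  loewner_le (D^-1 *: Fbar) F -> loewner_le F (D *: Fbar) ->
  l2norm (sqrtmx Fbar *m (m - tb)) ^+ 2 <= D * s%:R * L ->
  0 <= slab b k X lambda y t <= slab_bound t.
Proof.
move=> m F F_psd lo up near.
have F_pd : posdefmx F.
  by apply: posdefmx_ge lo F_psd.1; apply: posdefmxZ => //; rewrite invr_gt0.
rewrite slab_eq // -/m -/F; apply/andP; split.
  by rewrite mulr_ge0 ?sqrtr_ge0 ?expR_ge0.
apply: ler_pM; [exact: sqrtr_ge0|exact: expR_ge0| |].
  have h : 0 < (2 * pi : R) ^+ s by rewrite exprn_gt0 // mulr_gt0 // pi_gt0.
  have lF : loewner_le (lambda *: F) ((lambda * D) *: Fbar).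
    split; first by rewrite -scalerA -scalerBr linearZ /= up.1.
    by move=> v; rewrite -scalerA -scalerBr qformZ mulr_ge0 ?(ltW lambda_gt0) ?up.2.
  have lD : 0 < lambda * D by rewrite mulr_gt0.
  have dl := det_posdef_gt0 (posdefmxZ lD Fbar_pd).
  rewrite ler_sqrt; last by rewrite divr_ge0 ?(ltW dl) ?(ltW h).
  apply: ler_wpM2r; first by rewrite invr_ge0 (ltW h).
  exact: (det_loewner_le (posdefmxZ lambda_gt0 F_pd) (posdefmxZ lD Fbar_pd) lF).
rewrite -expRD ler_expR qformZ.
have h1 : D^-1 * qform Fbar (t - m) <= qform F (t - m).
  by rewrite -qformZ -subr_ge0 -qformB lo.2.
have h2 : qform Fbar (t - tb) <= 2 * qform Fbar (t - m) + 2 * (D * s%:R * L).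
  rewrite (_ : t - tb = (t - m) + (m - tb)); last by rewrite addrA subrK.
  apply: le_trans (qform_add_le _ _ (posdef_psd Fbar_pd)) _.
  rewrite lerD2l; apply: ler_wpM2l; first exact: ler0n.
  by rewrite (qform_sqrtmx _ (posdef_psd Fbar_pd)).
have h3 : lambda / (2 * D) * qform Fbar (t - tb)
    <= lambda * qform F (t - m) + lambda * s%:R * L.
  apply: (@le_trans _ _ (lambda / (2 * D) * (2 * qform Fbar (t - m) + 2 * (D * s%:R * L)))).
    by rewrite ler_pM2l // divr_gt0 // mulr_gt0.
  rewrite (_ : _ * (_ + _) = lambda * (D^-1 * qform Fbar (t - m)) + lambda * s%:R * L).
    by rewrite lerD2r ler_pM2l.
  by field; rewrite gt_eqF.
move: h3; clear; move: (lambda / (2 * D) * _) => q2; move: (qform F _) => q1; lra.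
Qed.

Lemma jointly_measurable_slab_bound {dsp} {T : measurableType dsp} :
  jointly_measurable (fun (_ : T) t => (slab_bound t)%:E).
Proof.
move=> dsp' T' tau g mtau mg; apply/measurable_EFinP; apply: measurable_funM => //.
apply: measurable_funM => //.
have := @jointly_measurable_gauss R _ _ T ((lambda / (2 * D)) *: Fbar) tb
  _ _ tau g mtau mg.
by move/measurable_EFinP.
Qed.

Lemma intcV_slab_bound :
  lebesgue_integral_cV (fun t => (slab_bound t)%:E)
    = (expR (lambda * s%:R * L / 2) * (Num.sqrt 2 * D) ^+ s)%:E.
Proof.
have c0 : 0 < lambda / (2 * D) by rewrite divr_gt0 // mulr_gt0.
have [detF iF] := intcV_gauss tb (posdefmxZ c0 Fbar_pd).
have p0 : 0 < (2 * pi : R) ^+ s by rewrite exprn_gt0 // mulr_gt0 // pi_gt0.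
have dF := det_posdef_gt0 Fbar_pd.
rewrite /slab_bound; under eq_fun => t do rewrite mulrA EFinM.
rewrite (@intcVZ R s _ unit _ (fun _ t => (expR
    (- (qform ((lambda / (2 * D)) *: Fbar) (t - tb) / 2)))%:E) tt).
- rewrite iF -EFinM; congr EFin; rewrite mulrAC mulrC; congr (_ * _).
  have lD : 0 < lambda * D by rewrite mulr_gt0.
  have sq : ((Num.sqrt 2 * D) ^+ s) ^+ 2 = (2 * D ^+ 2) ^+ s.
    by rewrite -exprM mulnC exprM; congr (_ ^+ _); rewrite exprMn sqr_sqrtr.
  have ratio : \det ((lambda * D) *: Fbar) / (2 * pi) ^+ s
      * ((2 * pi) ^+ s / \det ((lambda / (2 * D)) *: Fbar)) = (2 * D ^+ 2) ^+ s.
    rewrite (_ : 2 * D ^+ 2 = (lambda * D) / (lambda / (2 * D))); last first.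
      by field; rewrite !gt_eqF.
    rewrite !detZ [in RHS]expr_div_n mulrA divfK ?gt_eqF //.
    by rewrite invfM mulrACA mulfV ?mulr1 // gt_eqF.
  have dl := det_posdef_gt0 (posdefmxZ lD Fbar_pd).
  rewrite -sqrtrM; last by rewrite divr_ge0 ?(ltW dl) ?(ltW p0).
  rewrite ratio -sq sqrtr_sqr ger0_norm // exprn_ge0 // mulr_ge0 ?sqrtr_ge0 //.
  exact: ltW.
- by rewrite mulr_ge0 ?sqrtr_ge0 ?expR_ge0.
- by move=> _ t; rewrite lee_fin expR_ge0.
- exact: jointly_measurable_gauss.
Qed.

End SlabUpper.

Section SlabLower.
Context {R : realType}.
Variables (d : nat) (F : 'M[R]_d) (m : 'cV[R]_d).
Hypothesis F_pd : posdefmx F.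

Definition truncated_gauss (kap : R) (t : 'cV[R]_d) : R :=
  \1_[set x : R | x <= 1] (qform F (t - m)) * expR (- (kap * qform F (t - m) / 2)).

Lemma jointly_measurable_truncated_gauss {dsp} {T : measurableType dsp} kap :
  jointly_measurable (fun (_ : T) t => (truncated_gauss kap t)%:E).
Proof.
move=> dsp' T' tau g mtau mg; apply/measurable_EFinP.
have mq : measurable_fun setT (fun t => qform F (\col_i g i t - m)).
  apply: measurable_qform => i.
  rewrite (_ : (fun t => _) = fun t => g i t - m i 0); last first.
    by apply/funext => t; rewrite !mxE.
  exact: measurable_funB.
apply: measurable_funM.
  have mi : measurable_fun setT (\1_[set x : R | x <= 1] : R -> R).
    apply: measurable_indic.
    have -> : [set x : R | x <= 1] = `]-oo, 1]%classic.
      by apply/seteqP; split => x /=; rewrite in_itv.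
    exact: measurable_itv.
  exact: (measurableT_comp mi mq).
apply: measurableT_comp => //; apply: measurableT_comp => //.
by apply: measurable_funM => //; apply: measurable_funM.
Qed.

(** When [kap] is large compared with the dimension, most of the mass of the
    Gaussian lies in the unit ellipsoid: outside it, half of the exponent is
    already worth the factor [exp (- kap / 4)]. *)
Lemma intcV_truncated_gauss_ge (kap : R) : 4 * (d%:R + 1) <= kap ->
  ((Num.sqrt ((2 * pi) ^+ d / \det (kap *: F)) / 2)%:E
   <= lebesgue_integral_cV (fun t => (truncated_gauss kap t)%:E))%E.
Proof.
move=> kd; have kap0 : 0 < kap.
  by apply: lt_le_trans kd; rewrite mulr_gt0 // ltr_wpDl.
have kap20 : 0 < kap / 2 by rewrite divr_gt0.
set J := lebesgue_integral_cV _; set G := Num.sqrt _.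
have dF := det_posdef_gt0 F_pd.
have p0 : 0 < (2 * pi : R) ^+ d by rewrite exprn_gt0 // mulr_gt0 // pi_gt0.
have [_ i1] := intcV_gauss m (posdefmxZ kap0 F_pd).
have [_ i2] := intcV_gauss m (posdefmxZ kap20 F_pd).
have G2 : Num.sqrt ((2 * pi) ^+ d / \det ((kap / 2) *: F)) = Num.sqrt 2 ^+ d * G.
  rewrite /G !detZ -sqrtr_exp // -sqrtrM ?exprn_ge0 //; congr Num.sqrt.
  have h1 : 2 ^+ d != 0 :> R by rewrite gt_eqF // exprn_gt0.
  have h2 : kap ^+ d != 0 by rewrite gt_eqF // exprn_gt0.
  by rewrite expr_div_n; field; rewrite h1 h2 gt_eqF.
have g0 (A : 'M[R]_d) (t : 'cV[R]_d) : (0 <= (expR (- (qform A (t - m) / 2)))%:E)%E.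
  by rewrite lee_fin expR_ge0.
have t0 t : (0 <= (truncated_gauss kap t)%:E)%E.
  by rewrite lee_fin mulr_ge0 ?expR_ge0.
have : (G%:E <= J + (expR (- (kap / 4)))%:E * (Num.sqrt 2 ^+ d * G)%:E)%E.
  rewrite -G2 -i1 -i2.
  rewrite -(@intcVZ R d _ unit _ (fun _ t =>
    (expR (- (qform ((kap / 2) *: F) (t - m) / 2)))%:E) tt) ?expR_ge0 //; last first.
    exact: jointly_measurable_gauss.
  rewrite -(@intcVD R d _ unit (fun _ t => (truncated_gauss kap t)%:E)
     (fun _ t => ((expR (- (kap / 4)))%:E *
       (expR (- (qform ((kap / 2) *: F) (t - m) / 2)))%:E)%E) tt) //.
  - apply: le_intcV => t; first exact: g0.
    rewrite -EFinM -EFinD lee_fin /truncated_gauss !qformZ indicE.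
    have [q1|q1] := boolP (_ \in _).
      by rewrite mul1r lerDl mulr_ge0 // expR_ge0.
    rewrite mul0r add0r -expRD ler_expR.
    have : 1 < qform F (t - m).
      by rewrite ltNge; apply: contra q1 => q1; rewrite inE.
    by nra.
  - exact: jointly_measurable_truncated_gauss.
  - move=> dsp' T' tau g mtau mg; apply: measurable_funeM.
    exact: (@jointly_measurable_gauss R d _ unit ((kap / 2) *: F) m _ _ tau g mtau mg).
have G0 : 0 <= G by rewrite sqrtr_ge0.
have hE : expR (- (kap / 4)) * Num.sqrt 2 ^+ d <= 2^-1.
  rewrite expRN ler_pdivrMl ?expR_gt0 //.
  have e2 : (2 : R) <= expR 1 by have := expR_ge1Dx (1 : R); lra.
  have s2 : Num.sqrt 2 <= (2 : R).
    by rewrite -[leRHS]ger0_norm // -sqrtr_sqr ler_sqrt ?sqr_ge0 // expr2; lra.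
  have h1 : Num.sqrt 2 ^+ d <= (2 : R) ^+ d by rewrite lerXn2r ?nnegrE ?sqrtr_ge0.
  have h2 : (2 : R) ^+ d.+1 <= expR (kap / 4).
    apply: (@le_trans _ _ (expR (d.+1%:R))); last first.
      by rewrite ler_expR -natr1; lra.
    rewrite -[d.+1%:R]mulr1 mulrC expRM_natr.
    by rewrite lerXn2r ?nnegrE ?expR_ge0.
  by apply: (le_trans h1); move: h2; rewrite exprS; lra.
rewrite -EFinM => h.
have h' : ((G / 2)%:E <= G%:E - (expR (- (kap / 4)) * (Num.sqrt 2 ^+ d * G))%:E)%E.
  rewrite -EFinB lee_fin mulrA; nra.
apply: (le_trans h'); rewrite leeBlDr //.
Qed.

End SlabLower.

(** * Evidence of a model and posterior ratios *)

Section GoodMle.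
Context {R : realType}.
Variables (b k : R -> R) (Cdev : R).
Hypothesis b_conv : strictly_convex b.
Hypothesis b_diff :
  forall (j : nat) (x : R), (j < 3)%N -> derivable (derive1n j b) x 1.
Hypothesis Cdev_ge1 : 1 <= Cdev.
Hypothesis b_dev :
  forall x y : R, `|y| <= 2^-1 -> derive1n 2 b (x + y) <= Cdev * derive1n 2 b x.
Variables (n d : nat) (Z : 'M[R]_(n, d)) (y : 'I_n -> R).

(** A small standardized score confines the maximum likelihood estimator to the
    region around [t0] where all linear predictors move by at most one half,
    so that the estimated information inherits the properties of the true
    one. *)
Lemma mle_fisher_good (t0 t : 'cV[R]_d) (z s r : R) :
  is_mle b k Z y t -> fisher b Z t0 \in unitmx ->
  0 < r -> 0 <= s -> 2 * Cdev * (Num.sqrt d%:R * s) < r ->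
  0 <= z -> z * r <= 2^-1 -> Cdev <= r ^+ 2 ->
  (forall i, l2norm (invmx (sqrtmx (fisher b Z t0)) *m (row i Z)^T) <= z) ->
  (forall j, `|std_score b Z t0 y j| <= s) ->
  posdefmx (fisher b Z t) /\
  forall u i, `|(Z *m u) i 0| <= 2^-1 * Num.sqrt (qform (fisher b Z t) u).
Proof.
move=> tmle F0u r0 s0 sr z0 zr Cr hz hs.
have C0 : 0 < Cdev by exact: lt_le_trans Cdev_ge1.
have F0psd := fisher_psd b_conv b_diff Cdev_ge1 b_dev Z t0.
have F0pd := psd_unit_posdef F0psd F0u.
have hZ u i : `|(Z *m u) i 0| <= z * Num.sqrt (qform (fisher b Z t0) u).
  apply: le_trans (design_entry_le F0psd F0u u i) _.
  by rewrite ler_wpM2r ?sqrtr_ge0.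
have loc := mle_localized b_conv b_diff Cdev_ge1 b_dev tmle r0 zr sr hZ
  (fun u => score_le F0psd F0u u s0 hs).
have cmp v : qform (fisher b Z t0) v <= Cdev * qform (fisher b Z t) v.
  apply: (fisher_qform_le b_dev) => i; apply: le_trans (hZ _ _) _.
  by apply: le_trans zr; rewrite ler_wpM2l.
split.
  split; first exact: (fisher_psd b_conv b_diff Cdev_ge1 b_dev Z t).1.
  move=> v v0; have := F0pd.2 v v0 => h; have := lt_le_trans h (cmp v).
  by rewrite pmulr_rgt0.
move=> u i; apply: le_trans (hZ u i) _.
apply: (@le_trans _ _ (z * (r * Num.sqrt (qform (fisher b Z t) u)))); last first.
  by rewrite mulrA ler_wpM2r ?sqrtr_ge0.
rewrite ler_wpM2l // -[r]gtr0_norm // -sqrtr_sqr -sqrtrM ?sqr_ge0 //.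
apply: ler_wsqrtr; apply: le_trans (cmp u) _; rewrite ler_wpM2r //.
exact: (fisher_psd b_conv b_diff Cdev_ge1 b_dev Z t).2.
Qed.

End GoodMle.

Section EvidenceLower.
Context {R : realType}.
Variables (b k : R -> R) (Cdev : R).
Hypothesis b_conv : strictly_convex b.
Hypothesis b_diff :
  forall (j : nat) (x : R), (j < 3)%N -> derivable (derive1n j b) x 1.
Hypothesis Cdev_ge1 : 1 <= Cdev.
Hypothesis b_dev :
  forall x y : R, `|y| <= 2^-1 -> derive1n 2 b (x + y) <= Cdev * derive1n 2 b x.
Variables (n p : nat) (X : 'M[R]_(n, p)) (lambda alpha : R) (y : 'I_n -> R).
Hypothesis lambda_gt0 : 0 < lambda.
Hypothesis alpha01 : 0 < alpha < 1.

(** Laplace-type lower bound for the contribution of one model, from the unit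
    ellipsoid around its maximum likelihood estimator, on which the
    log-likelihood is at least quadratic. *)
Lemma evidence_ge (S : {set 'I_p}) (t0 : 'cV[R]_#|S|) :
  let Z := cols X S in let m := mle b k Z y in let F := fisher b Z m in
  is_mle b k Z y m -> posdefmx F ->
  (forall u i, `|(Z *m u) i 0| <= 2^-1 * Num.sqrt (qform F u)) ->
  ((expR (alpha * loglik b k X y (extend t0))
     * (Num.sqrt (lambda / (Cdev + lambda + 4 * (#|S|%:R + 1))) ^+ #|S| / 2))%:E
   <= lebesgue_integral_cV (fun t : 'cV[R]_#|S| =>
        (expR (alpha * loglik b k X y (extend t)) * slab b k X lambda y t)%:E))%E.
Proof.
move=> Z m F mmle F_pd small; set kap := Cdev + _ + _.
set c0 := expR (alpha * _).
have kapd : 4 * (#|S|%:R + 1) <= kap.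
  by rewrite /kap lerDr addr_ge0 ?(ltW lambda_gt0) // (le_trans ler01 Cdev_ge1).
have kap0 : 0 < kap by apply: lt_le_trans kapd; rewrite mulr_gt0 // ltr_wpDl.
pose K := Num.sqrt (\det (lambda *: F) / (2 * pi) ^+ #|S|).
have dF := det_posdef_gt0 F_pd.
have p0 : 0 < (2 * pi : R) ^+ #|S| by rewrite exprn_gt0 // mulr_gt0 // pi_gt0.
have c00 : 0 <= c0 by exact: expR_ge0.
have K0 : 0 <= K by exact: sqrtr_ge0.
have tg0 t : (0 <= (truncated_gauss F m kap t)%:E)%E.
  by rewrite lee_fin mulr_ge0 ?expR_ge0.
apply: (@le_trans _ _ (lebesgue_integral_cV (fun t =>
    ((c0 * K)%:E * (truncated_gauss F m kap t)%:E)%E))).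
  rewrite (@intcVZ R _ _ unit _ (fun _ t => (truncated_gauss F m kap t)%:E) tt)
    ?mulr_ge0 //; last exact: jointly_measurable_truncated_gauss.
  apply: (@le_trans _ _ ((c0 * K)%:E
      * (Num.sqrt ((2 * pi) ^+ #|S| / \det (kap *: F)) / 2)%:E)%E).
    rewrite -EFinM lee_fin -mulrA ler_wpM2l // mulrA -sqrtrM; last first.
      by rewrite divr_ge0 ?(ltW p0) // detZ mulr_ge0 ?exprn_ge0 ?ltW.
    rewrite ler_pM2r // -sqrtr_exp; last by rewrite divr_ge0 ?ltW.
    apply: ler_wsqrtr; rewrite le_eqVlt; apply/orP; left; apply/eqP.
    have ks0 : kap ^+ #|S| != 0 by rewrite gt_eqF // exprn_gt0.
    move: p0 dF ks0; rewrite !detZ expr_div_n; clear.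
    move: (\det F) ((2 * pi) ^+ _) (kap ^+ _) (lambda ^+ _) => a1 a2 a3 a4 a20 a10 a30.
    by field; rewrite a30 !gt_eqF.
  by apply: lee_wpmul2l; [rewrite lee_fin mulr_ge0|exact: intcV_truncated_gauss_ge].
apply: le_intcV => t; first by rewrite mule_ge0 // lee_fin mulr_ge0.
rewrite -EFinM lee_fin slab_eq // -/Z -/m -/F -/K.
rewrite [leLHS]mulrAC [leLHS]mulrC [leRHS]mulrCA; apply: ler_wpM2l => //.
rewrite /truncated_gauss indicE.
have [q1|_] := boolP (_ \in _); last by rewrite mul0r mulr0 mulr_ge0 ?expR_ge0.
move: q1; rewrite inE /= mul1r => q1.
have q0 : 0 <= qform F (t - m) := (posdef_psd F_pd).2 _.
have sq1 : Num.sqrt (qform F (t - m)) <= 1 by rewrite -[leRHS]sqrtr1 ler_wsqrtr.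
have small' i : `|(Z *m (t - m)) i 0| <= 2^-1.
  by apply: le_trans (small _ _) _; rewrite ler_piMr.
have := mle_gap_ge b_conv b_diff Cdev_ge1 b_dev mmle small'.
rewrite [m + _]addrC subrK -/F => gap.
rewrite /c0 -!expRD ler_expR loglik_extend loglik_extend -/Z.
have := mmle t0; rewrite /kap; set q := qform F _ in q0 q1 gap *.
set l0 := loglik _ _ _ _ t0; set lm := loglik _ _ _ _ m in gap *.
set lt := loglik _ _ _ _ t in gap *; move=> l0m.
case/andP: alpha01 => a0 a1.
have a_gap : alpha * l0 - Cdev * q / 2 <= alpha * lt.
  have Cq : 0 <= Cdev * q by rewrite mulr_ge0 // (le_trans ler01 Cdev_ge1).
  nra.
have : 0 <= (4 * (#|S|%:R + 1)) * q by rewrite !mulr_ge0 ?addr_ge0.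
by nra.
Qed.

End EvidenceLower.

Section PosteriorBounds.
Context {R : realType}.
Variables (b k : R -> R) (n p : nat) (X : 'M[R]_(n, p)).
Variables (smax : nat) (w : nat -> R) (lambda alpha : R) (y : 'I_n -> R).
Hypothesis w_ge0 : forall s, (s <= smax)%N -> 0 <= w s.
Local Open Scope ereal_scope.

Local Notation prior_int f := (prior_integral b k X smax w lambda y f).

Lemma model_prior_ge0 (S : {set 'I_p}) : (#|S| <= smax)%N -> (0 <= model_prior w S)%R.
Proof. by move=> hS; rewrite /model_prior divr_ge0 // w_ge0. Qed.

Lemma slab_ge0 (S : {set 'I_p}) (t : 'cV[R]_#|S|) : (0 <= slab b k X lambda y t)%R.
Proof. by rewrite /slab /mvn_pdf mulr_ge0 ?expR_ge0 // invr_ge0 sqrtr_ge0. Qed.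

Let integrand_ge0 (f : 'cV[R]_p -> R) (S : {set 'I_p}) :
  (forall v, (0 <= f v)%R) ->
  0 <= lebesgue_integral_cV (fun t : 'cV[R]_#|S| =>
    (f (extend t) * slab b k X lambda y t)%:E).
Proof. by move=> f0; apply: intcV_ge0 => t; rewrite lee_fin mulr_ge0 ?slab_ge0. Qed.

Lemma prior_integral_ge0 f : (forall v, (0 <= f v)%R) -> 0 <= prior_int f.
Proof.
move=> f0; apply: sume_ge0 => S hS; rewrite mule_ge0 //.
  by rewrite lee_fin model_prior_ge0.
exact: integrand_ge0.
Qed.

Lemma le_prior_integral f g : (forall v, (0 <= f v)%R) -> (forall v, (f v <= g v)%R) ->
  prior_int f <= prior_int g.
Proof.
move=> f0 fg; apply: lee_sum => S hS; apply: lee_wpmul2l.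
  by rewrite lee_fin model_prior_ge0.
apply: le_intcV => t; first by rewrite lee_fin mulr_ge0 ?slab_ge0.
by rewrite lee_fin ler_wpM2r ?slab_ge0.
Qed.

Variable A : set 'cV[R]_p.

Let Num := prior_int (fun theta => expR (alpha * loglik b k X y theta) * \1_A theta)%R.
Let Den := prior_int (fun theta => expR (alpha * loglik b k X y theta))%R.

Let Num_ge0 : 0 <= Num.
Proof. by apply: prior_integral_ge0 => v; rewrite mulr_ge0 ?expR_ge0. Qed.

Let Num_le : Num <= Den.
Proof.
apply: le_prior_integral => v; first by rewrite mulr_ge0 ?expR_ge0.
by rewrite ler_piMr ?expR_ge0 // indicE; case: (v \in A).
Qed.

Lemma posterior_ge0 : (0 <= posterior b k X smax w lambda alpha y A)%R.
Proof.
rewrite /posterior -/Num -/Den divr_ge0 // fine_ge0 //.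
exact: le_trans Num_le.
Qed.

(** This holds even if the normalising integral is zero or infinite, as the quotient
    is then 0. *)
Lemma posterior_le1 : (posterior b k X smax w lambda alpha y A <= 1)%R.
Proof.
rewrite /posterior -/Num -/Den.
have [->|Den_fin] := eqVneq Den +oo; first by rewrite /= invr0 mulr0 ler01.
have D0 : 0 <= Den by exact: le_trans Num_le.
have Df : Den \is a fin_num by rewrite ge0_fin_numE // lt_neqAle Den_fin leey.
have Nf : Num \is a fin_num.
  by rewrite ge0_fin_numE //; apply: le_lt_trans Num_le _; rewrite -ge0_fin_numE.
have [d0|dn0] := eqVneq (fine Den) 0%R; first by rewrite d0 invr0 mulr0 ler01.
rewrite ler_pdivrMr ?mul1r; last by rewrite lt_def dn0 fine_ge0.
exact: fine_le.
Qed.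

Lemma posterior_le (l c : R) (M : \bar R) : (0 < c)%R -> (0 < l)%R -> 0 <= M ->
  Num <= l%:E * M -> (l * c)%:E <= Den ->
  (posterior b k X smax w lambda alpha y A)%:E <= c^-1%:E * M.
Proof.
move=> c0 l0 M0 hN hD; rewrite /posterior -/Num -/Den.
have [->|Mfin] := eqVneq M +oo.
  by rewrite gt0_muley ?leey // lte_fin invr_gt0.
have Mf : M \is a fin_num by rewrite ge0_fin_numE // lt_neqAle Mfin leey.
have [->|Den_fin] := eqVneq Den +oo.
  by rewrite /= invr0 mulr0 mule_ge0 // lee_fin invr_ge0 ltW.
have D0 : 0 <= Den by exact: le_trans Num_le.
have Df : Den \is a fin_num by rewrite ge0_fin_numE // lt_neqAle Den_fin leey.
have Nf : Num \is a fin_num.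
  by rewrite ge0_fin_numE //; apply: le_lt_trans Num_le _; rewrite -ge0_fin_numE.
rewrite -(fineK Mf) -EFinM lee_fin.
move: hN hD; rewrite -(fineK Mf) -(fineK Nf) -(fineK Df) -EFinM !lee_fin => hN hD.
have lc0 : (0 < l * c)%R by rewrite mulr_gt0.
rewrite ler_pdivrMr; last exact: lt_le_trans hD.
apply: (le_trans hN).
have m0 : (0 <= fine M)%R by exact: fine_ge0.
apply: (@le_trans _ _ (c^-1 * fine M * (l * c)))%R.
  by rewrite le_eqVlt; apply/orP; left; apply/eqP; field; rewrite gt_eqF.
by rewrite ler_wpM2l // mulr_ge0 // invr_ge0 ltW.
Qed.

End PosteriorBounds.

(** * The posterior at a fixed sample size *)

Section FixedSampleSize.
Context {R : realType} {dsp : measure_display} {Omega : measurableType dsp}.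
Variables (nu : {sigma_finite_measure set R -> \bar R}) (b k : R -> R) (Cdev : R).
Hypothesis k_meas : measurable_fun setT k.
Hypothesis b_conv : strictly_convex b.
Hypothesis b_diff :
  forall (j : nat) (x : R), (j < 3)%N -> derivable (derive1n j b) x 1.
Hypothesis family_density : forall eta : R,
  (\int[nu]_y (glm_density b k eta y)%:E)%E = 1%E.
Hypothesis Cdev_ge1 : 1 <= Cdev.
Hypothesis b_dev :
  forall x y : R, `|y| <= 2^-1 -> derive1n 2 b (x + y) <= Cdev * derive1n 2 b x.
Variables (n p : nat) (X : 'M[R]_(n, p)) (theta0 : 'cV[R]_p).
Variables (P : probability Omega R) (Y : 'I_n -> {RV P >-> R}).
Hypothesis Y_indep : mutually_independent Y.
Hypothesis Y_law : forall i, has_glm_law nu b k (Y i) ((X *m theta0) i 0).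
Hypothesis kY_int :
  forall i, P.-integrable setT (fun omega => (k (Y i omega))%:E).
Variables (smax : nat) (w : nat -> R) (lambda alpha D L Kdim : R).
Hypothesis w_ge0 : forall s, (s <= smax)%N -> 0 <= w s.
Hypothesis lambda_gt0 : 0 < lambda.
Hypothesis alpha01 : 0 < alpha < 1.
Hypothesis D_gt0 : 0 < D.
Variable thetabar : forall S : {set 'I_p}, 'cV[R]_#|S|.
Hypothesis thetabar_nonsing : forall S : {set 'I_p}, (#|S| <= smax)%N ->
  fisher b (cols X S) (thetabar S) \in unitmx.

Local Notation S0 := (supp theta0).
Local Notation Z0 := (cols X S0).
Local Notation Yat w := (fun i => Y i w).

Let Fbar (S : {set 'I_p}) := fisher b (cols X S) (thetabar S).

Let Fbar_pd (S : {set 'I_p}) : (#|S| <= smax)%N -> posdefmx (Fbar S).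
Proof.
move=> hS; apply: psd_unit_posdef; last exact: thetabar_nonsing.
exact: (fisher_psd b_conv b_diff Cdev_ge1 b_dev).
Qed.

Definition big_support : set 'cV[R]_p :=
  [set theta | Kdim * #|S0|%:R < #|supp theta|%:R].

Definition big_model (S : {set 'I_p}) : bool := Kdim * #|S0|%:R < #|S|%:R.

Let ratio_bound (S : {set 'I_p}) (omega : Omega) (t : 'cV[R]_#|S|) : \bar R :=
  (expR (alpha * (loglik b k X (Yat omega) (extend t)
                  - loglik b k X (Yat omega) theta0))
   * slab_bound b X lambda D L (thetabar S) t)%:E.

(** A majorant of the unnormalised posterior mass of the large models, relative
    to the likelihood at the truth.  Unlike the posterior itself it is
    measurable, since the data-dependent slab has been replaced. *)
Definition mass_bound (omega : Omega) : \bar R :=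
  (\sum_(S : {set 'I_p} | (#|S| <= smax)%N && big_model S)
    (model_prior w S)%:E * lebesgue_integral_cV (@ratio_bound S omega))%E.

Definition mass_bound_mean : R :=
  \sum_(S : {set 'I_p} | (#|S| <= smax)%N && big_model S)
    model_prior w S * (expR (lambda * #|S|%:R * L / 2) * (Num.sqrt 2 * D) ^+ #|S|).

Let ratio_bound_ge0 (S : {set 'I_p}) omega t : (0 <= @ratio_bound S omega t)%E.
Proof.
by rewrite lee_fin mulr_ge0 ?expR_ge0 ?slab_bound_ge0.
Qed.

Let b_meas : measurable_fun setT b.
Proof.
apply: continuous_measurable_fun => x.
by apply: differentiable_continuous; apply/derivable1_diffP; exact: (@b_diff 0).
Qed.

Lemma measurable_loglik {dsp'} {T' : measurableType dsp'}
    (y : 'I_n -> T' -> R) (theta : T' -> 'cV[R]_p) :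
  (forall i, measurable_fun setT (y i)) ->
  (forall j, measurable_fun setT (fun t => theta t j 0)) ->
  measurable_fun setT (fun t => loglik b k X (fun i => y i t) (theta t)).
Proof.
move=> my mt; apply: measurable_sum => i.
have mZ : measurable_fun setT (fun t => (X *m theta t) i 0).
  rewrite (_ : (fun t => _) = fun t => \sum_j X i j * theta t j 0); last first.
    by apply/funext => t; rewrite mxE.
  by apply: measurable_sum => j; apply: measurable_funM.
apply: measurable_funD; last exact: measurableT_comp.
apply: measurable_funB; first exact: measurable_funM.
exact: (measurableT_comp b_meas mZ).
Qed.

Let ratio_bound_meas (S : {set 'I_p}) : jointly_measurable (@ratio_bound S).
Proof.
move=> dsp' T' tau g mtau mg; apply/measurable_EFinP; apply: measurable_funM.
  apply: measurableT_comp => //; apply: measurable_funM => //.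
  have mY i : measurable_fun setT (fun t => Y i (tau t)).
    exact: (measurableT_comp (measurable_funP (Y i)) mtau).
  apply: measurable_funB.
    apply: measurable_loglik => // j.
    rewrite (_ : (fun t => _) = fun t =>
        \sum_(l < #|S|) if enum_val l == j then g l t else 0).
      by apply: measurable_sum => l; case: (enum_val l == j).
    apply/funext => t; rewrite mxE big_mkcond; apply: eq_bigr => l _.
    by rewrite mxE.
  by apply: (measurable_loglik (theta := fun=> theta0)).
have := @jointly_measurable_slab_bound R n p b X lambda D L S (thetabar S)
  _ T' _ _ id g (@measurable_id _ _ _) mg.
by move/measurable_EFinP.
Qed.

Let measurable_ratio_int (S : {set 'I_p}) :
  measurable_fun setT (fun omega => lebesgue_integral_cV (@ratio_bound S omega)).
Proof. by apply: measurable_intcV => [omega t|]; [exact: ratio_bound_ge0|]. Qed.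

Let ratio_int_ge0 (S : {set 'I_p}) omega :
  (0 <= lebesgue_integral_cV (@ratio_bound S omega))%E.
Proof. by apply: intcV_ge0 => t; exact: ratio_bound_ge0. Qed.

Let prior_ge0 (S : {set 'I_p}) :
  (#|S| <= smax)%N && big_model S -> 0 <= model_prior w S.
Proof. by move=> /andP[hS _]; apply: (model_prior_ge0 w_ge0). Qed.

Lemma mass_bound_ge0 omega : (0 <= mass_bound omega)%E.
Proof.
by apply: sume_ge0 => S hS; rewrite mule_ge0 ?lee_fin ?prior_ge0.
Qed.

Lemma measurable_mass_bound : measurable_fun setT mass_bound.
Proof.
rewrite /mass_bound.
under eq_fun => omega do rewrite big_mkcond.
apply: emeasurable_sum => S; case: (_ && big_model S) => //.
exact: measurable_funeM.
Qed.

(** By Tonelli's theorem and the fractional likelihood ratio bound. *)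
Lemma integral_mass_bound_le :
  (\int[P]_omega mass_bound omega <= mass_bound_mean%:E)%E.
Proof.
rewrite /mass_bound; under eq_integral => omega _ do rewrite big_mkcond.
rewrite ge0_integral_sum //; first last.
- move=> S omega _; case: ifP => // hS.
  by rewrite mule_ge0 ?lee_fin ?prior_ge0.
- by move=> S; case: (_ && big_model S) => //; exact: measurable_funeM.
rewrite /mass_bound_mean -sumEFin [leRHS]big_mkcond /=; apply: lee_sum => S _.
case: ifP => hS; last by rewrite integral0.
have pi0 := prior_ge0 hS.
rewrite ge0_integralZl //.
rewrite [leRHS](EFinM (model_prior w S)); apply: lee_wpmul2l => //.
rewrite (exchange_integral_intcV P (@ratio_bound_ge0 S) (@ratio_bound_meas S)).
have [hS1 _] := andP hS.
rewrite -(intcV_slab_bound L lambda_gt0 D_gt0 (Fbar_pd hS1)).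
apply: le_intcV => t.
  by apply: integral_ge0 => omega _; exact: ratio_bound_ge0.
rewrite /ratio_bound; set q := slab_bound _ _ _ _ _ _ _.
have q0 : 0 <= q by exact: slab_bound_ge0.
under eq_integral => omega _ do rewrite mulrC EFinM.
rewrite ge0_integralZl //.
- rewrite -[leRHS]mule1; apply: lee_wpmul2l => //.
  exact: (fractional_likelihood_le1 k_meas b_conv family_density Y_indep Y_law).
- apply/measurable_EFinP; apply: measurableT_comp => //; apply: measurable_funM => //.
  apply: measurable_funB.
    by apply: (measurable_loglik (theta := fun=> extend t)).
  by apply: (measurable_loglik (theta := fun=> theta0)).
Qed.

(** What is required of the maximum likelihood estimators at a data point. *)
Definition mle_regular (y : 'I_n -> R) : Prop :=
  forall S : {set 'I_p}, (#|S| <= smax)%N ->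
    let Z := cols X S in
    let Fhat := fisher b Z (mle b k Z y) in
    [/\ is_mle b k Z y (mle b k Z y),
        loewner_le (D^-1 *: Fbar S) Fhat,
        loewner_le Fhat (D *: Fbar S) &
        l2norm (sqrtmx (Fbar S) *m (mle b k Z y - thetabar S)) ^+ 2
          <= D * #|S|%:R * L].

Lemma posterior_numerator_le omega : mle_regular (Yat omega) ->
  (prior_integral b k X smax w lambda (Yat omega)
     (fun theta => expR (alpha * loglik b k X (Yat omega) theta)
                   * \1_big_support theta)%R
   <= (expR (alpha * loglik b k X (Yat omega) theta0))%:E * mass_bound omega)%E.
Proof.
move=> reg; set l := expR _.
have l0 : 0 <= l by exact: expR_ge0.
rewrite /mass_bound ge0_sume_distrr; last first.
  by move=> S hS; rewrite mule_ge0 ?lee_fin ?prior_ge0.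
rewrite big_mkcondr /=; apply: lee_sum => S hS.
have pi0 : 0 <= model_prior w S by exact: (model_prior_ge0 w_ge0).
have [m_ok lo up near] := reg S hS.
have slab_ok t := slab_le_bound lambda_gt0 D_gt0 (Fbar_pd hS) t
  (fisher_psd b_conv b_diff Cdev_ge1 b_dev _ _) lo up near.
case: ifP => [hbig|hbig]; last first.
  rewrite (_ : (fun t => _) = fun t : 'cV[R]_#|S| => 0%E) ?intcV0 ?mule0 //.
  apply/funext => t; rewrite indicE memNset ?mulr0 ?mul0r // /big_support /=.
  move=> h; have := lt_le_trans h _; rewrite -/(big_model S).
  move=> /(_ #|S|%:R); rewrite ler_nat subset_leq_card ?supp_extend // => /(_ isT).
  by rewrite -/(big_model S) hbig.
rewrite muleCA; apply: lee_wpmul2l; first by rewrite lee_fin.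
rewrite -(intcVZ omega l0 (@ratio_bound_ge0 S) (@ratio_bound_meas S)).
apply: le_intcV => t.
  rewrite lee_fin !mulr_ge0 ?expR_ge0 //; exact: (slab_ge0 _ _).
rewrite /ratio_bound -EFinM lee_fin [leRHS]mulrA /l -expRD -mulrDr.
rewrite [_ theta0 + _]addrC subrK -[leLHS]mulrA.
apply: ler_wpM2l; first exact: expR_ge0.
case/andP: (slab_ok t) => h0 h1.
by apply: le_trans h1; rewrite ler_piMl // indicE; case: (_ \in _).
Qed.


Let t0 : 'cV[R]_#|S0| := \col_(l < #|S0|) theta0 (enum_val l) 0.

Let extend_t0 : extend t0 = theta0. Proof. exact: extend_supp. Qed.

Let Y_law0 i : has_glm_law nu b k (Y i) ((Z0 *m t0) i 0).
Proof. by rewrite -mulmx_extend extend_t0. Qed.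

Hypothesis fisher_star_nonsing : fisher_star b k X Y S0 \in unitmx.

Let theta_starE : theta_star b k Z0 Y = t0.
Proof.
exact: (theta_star_true k_meas b_conv b_diff family_density Cdev_ge1 b_dev
  Y_indep kY_int Y_law0 fisher_star_nonsing).
Qed.

Let F0 := fisher b Z0 t0.

Let F0_unit : F0 \in unitmx.
Proof. by move: fisher_star_nonsing; rewrite /fisher_star theta_starE. Qed.

Let F0_psd : psdmx F0.
Proof. exact: (fisher_psd b_conv b_diff Cdev_ge1 b_dev). Qed.

Local Notation zeta0 := (zeta b k X Y S0).

Let leverage_le i : l2norm (invmx (sqrtmx F0) *m (row i Z0)^T) <= zeta0.
Proof.
rewrite /zeta /fisher_star theta_starE -/F0.
exact: (le_bigmax _ (fun i => l2norm (invmx (sqrtmx F0) *m (row i Z0)^T))).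
Qed.

Lemma zeta_ge0 : 0 <= zeta0.
Proof. exact: bigmax_ge_id. Qed.

Definition small_score (tau : R) : set Omega :=
  [set omega | forall j, `|std_score b Z0 t0 (Yat omega) j| <= tau].

Let measurable_std_score j :
  measurable_fun setT (fun omega => std_score b Z0 t0 (Yat omega) j).
Proof.
apply: measurable_sum => i; apply: measurable_funM => //.
by apply: measurable_funB => //; exact: measurable_funP.
Qed.

Lemma measurable_small_score tau : measurable (small_score tau).
Proof.
rewrite (_ : small_score tau = \bigcap_(j in [set: 'I_#|S0|])
    [set omega | `|std_score b Z0 t0 (Yat omega) j| <= tau]).
  apply: fin_bigcap_measurable => // j _.
  rewrite -[X in measurable X]setTI.
  by apply: measurable_fun_le => //; apply: measurableT_comp.
by apply/seteqP; split => omega h j; [move=> _|]; apply: h.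
Qed.

(** Chernoff's bound for each coordinate of the standardized score and for its
    opposite, then a union bound. *)
Lemma small_score_prob (sg : R) : 0 <= sg -> sg * zeta0 <= 2^-1 ->
  (P (~` small_score (Cdev * sg))
     <= (#|S0|%:R * (2 * expR (- (Cdev * sg ^+ 2 / 2))))%:E)%E.
Proof.
move=> sg0 sgz; set q := expR _; pose C := std_design b Z0 t0.
have C_le i j : `|C i j| <= zeta0.
  apply: le_trans (leverage_le i).
  rewrite -(ler_pXn2r (n := 2)) ?nnegrE ?sqrtr_ge0 //.
  rewrite real_normK ?num_real // /F0 std_design_norm //.
  by rewrite (bigD1 j) //= lerDl sumr_ge0 // => l _; exact: sqr_ge0.
pose A j := [set omega : Omega | (Cdev * sg <= \sum_i C i j *
  (Y i omega - derive1n 1 b ((Z0 *m t0) i 0)))%R].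
pose B j := [set omega : Omega | (Cdev * sg <= \sum_i (- C i j) *
  (Y i omega - derive1n 1 b ((Z0 *m t0) i 0)))%R].
have tail (c : 'I_n -> R) : (forall i, `|c i| <= zeta0) ->
    \sum_i derive1n 2 b ((Z0 *m t0) i 0) * c i ^+ 2 = 1 ->
    (P [set omega : Omega | (Cdev * sg <= \sum_i c i *
      (Y i omega - derive1n 1 b ((Z0 *m t0) i 0)))%R] <= q%:E)%E.
  move=> c1 c2.
  exact: (score_stat_tail k_meas b_diff family_density b_dev Y_indep Y_law0 c1 sg0 sgz c2).
have PA j : (P (A j) <= q%:E)%E.
  by apply: tail => [i|]; [exact: C_le|exact: std_design_info].
have PB j : (P (B j) <= q%:E)%E.
  apply: tail => [i|]; first by rewrite normrN.
  by rewrite -(std_design_info F0_psd F0_unit j); apply: eq_bigr => i _; rewrite sqrrN.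
have mlin (c : 'I_n -> R) : measurable [set omega : Omega | (Cdev * sg <= \sum_i c i *
      (Y i omega - derive1n 1 b ((Z0 *m t0) i 0)))%R].
  rewrite -[X in measurable X]setTI; apply: measurable_fun_le => //.
  apply: measurable_sum => i; apply: measurable_funM => //.
  by apply: measurable_funB => //; exact: measurable_funP.
apply: (@le_trans _ _ (\sum_(j < #|S0|) P (A j `|` B j))%E).
  rewrite (bigfs _ (r := index_enum _)) ?index_enum_uniq //; last first.
    by move=> j _; rewrite mem_index_enum.
  apply: content_sub_fsum => //.
  - by move=> j _; apply: measurableU; exact: mlin.
  - by apply: measurableC; exact: measurable_small_score.
  - move=> omega /= /existsNP[j] /negP; rewrite -ltNge => hj.
    exists j => //; rewrite /A /B /=.
    have := hj; rewrite ltr_normr => /orP[h|h]; [left|right].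
      exact: ltW.
    under eq_bigr => i _ do rewrite mulNr.
    by rewrite sumrN; exact: ltW.
rewrite mulr_natl -[X in _ *+ X]card_ord -sumr_const -sumEFin.
apply: lee_sum => j _; apply: (le_trans (measureU2 _ _ _)) => //; try exact: mlin.
by rewrite mulr_natl mulr2n EFinD; apply: leeD; [exact: PA|exact: PB].
Qed.

Variables (E : set Omega) (q1 q2 tau r : R).
Hypothesis E_meas : measurable E.
Hypothesis E_prob : ((1 - q1)%:E <= P E)%E.
Hypothesis E_reg : forall omega, E omega -> mle_regular (Yat omega).
Hypothesis tau_ge0 : 0 <= tau.
Hypothesis tau_prob : (P (~` small_score tau) <= q2%:E)%E.
Hypothesis r_gt0 : 0 < r.
Hypothesis r_tau : 2 * Cdev * (Num.sqrt #|S0|%:R * tau) < r.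
Hypothesis zeta_r : zeta0 * r <= 2^-1.
Hypothesis Cdev_r : Cdev <= r ^+ 2.
Hypothesis S0_smax : (#|S0| <= smax)%N.
Hypothesis w0_gt0 : 0 < w #|S0|.

Definition evidence_bound : R :=
  model_prior w S0 * (Num.sqrt (lambda / (Cdev + lambda + 4 * (#|S0|%:R + 1))) ^+ #|S0| / 2).

Lemma evidence_bound_gt0 : 0 < evidence_bound.
Proof.
rewrite /evidence_bound /model_prior mulr_gt0 ?divr_gt0 ?exprn_gt0 //.
  by rewrite ltr0n bin_gt0 -[X in (_ <= X)%N]card_ord max_card.
have C0 : 0 < Cdev by exact: lt_le_trans Cdev_ge1.
have d0 : 0 < 4 * (#|S0|%:R + 1) :> R by rewrite mulr_gt0 // ltr_wpDl.
by rewrite sqrtr_gt0 divr_gt0 // !addr_gt0.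
Qed.

Lemma posterior_denominator_ge omega : E omega -> small_score tau omega ->
  ((expR (alpha * loglik b k X (Yat omega) theta0) * evidence_bound)%:E
   <= prior_integral b k X smax w lambda (Yat omega)
        (fun theta => expR (alpha * loglik b k X (Yat omega) theta)))%E.
Proof.
move=> hE hs; have [m_ok _ _ _] := E_reg hE S0_smax.
have [F_pd small] := mle_fisher_good b_conv b_diff Cdev_ge1 b_dev m_ok F0_unit
  r_gt0 tau_ge0 r_tau zeta_ge0 zeta_r Cdev_r leverage_le hs.
have := evidence_ge b_conv b_diff Cdev_ge1 b_dev lambda_gt0 alpha01 t0 m_ok F_pd small.
rewrite extend_t0 => ev.
rewrite /prior_integral (bigD1 S0) //=; apply: le_trans (leeDl _ _).
  rewrite /evidence_bound mulrCA EFinM; apply: lee_wpmul2l => //.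
  by rewrite lee_fin (model_prior_ge0 w_ge0).
apply: sume_ge0 => S /andP[hS _]; rewrite mule_ge0 ?lee_fin ?(model_prior_ge0 w_ge0) //.
by apply: intcV_ge0 => t; rewrite lee_fin mulr_ge0 ?expR_ge0 ?slab_ge0.
Qed.

(** The posterior mass need not be a measurable function of the data; its
    integral is a lower one and is bounded through the measurable majorant that
    is one off the good event. *)
Lemma posterior_mean_le :
  ('E_P[fun omega => posterior b k X smax w lambda alpha (Yat omega) big_support]
   <= (q1 + q2 + mass_bound_mean / evidence_bound)%:E)%E.
Proof.
have c0 := evidence_bound_gt0.
pose G := E `&` small_score tau.
have mG : measurable G by apply: measurableI => //; exact: measurable_small_score.
have mGc : measurable (~` G) by exact: measurableC.
have PE : (P (~` E) <= q1%:E)%E.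
  have Pfin : P E \is a fin_num by exact: fin_num_measure.
  rewrite probability_setC //; move: E_prob; rewrite -(fineK Pfin) -EFinB !lee_fin.
  by lra.
rewrite expectation.unlock.
apply: (@le_trans _ _ (\int[P]_omega
   ((\1_(~` G) omega)%:E + evidence_bound^-1%:E * mass_bound omega))%E).
  apply: ge0_le_integral_lower => omega.
    by rewrite lee_fin; exact: posterior_ge0.
  have M0 : (0 <= evidence_bound^-1%:E * mass_bound omega)%E.
    by rewrite mule_ge0 ?mass_bound_ge0 // lee_fin invr_ge0 ltW.
  rewrite indicE; have [hG|hG] := boolP (omega \in ~` G).
    apply: (@le_trans _ _ 1%:E); first by rewrite lee_fin; exact: posterior_le1.
    by rewrite leeDl.
  have [hE hs] : G omega.
    by apply: contrapT => h; move/negP: hG; apply; rewrite inE.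
  rewrite add0e; apply: (posterior_le w_ge0 c0 (expR_gt0 _) (mass_bound_ge0 _)).
    exact: posterior_numerator_le (E_reg hE).
  exact: posterior_denominator_ge.
rewrite ge0_integralD //; first last.
- by apply: measurable_funeM; exact: measurable_mass_bound.
- by move=> omega _; rewrite mule_ge0 ?mass_bound_ge0 // lee_fin invr_ge0 ltW.
- by apply/measurable_EFinP; exact: measurable_indic.
rewrite integral_indic // setIT ge0_integralZl //; first last.
- by rewrite lee_fin invr_ge0 ltW.
- by move=> omega _; exact: mass_bound_ge0.
- exact: measurable_mass_bound.
rewrite EFinD; apply: leeD.
  rewrite /G setCI; apply: (le_trans (measureU2 _ _ _)).
  - exact: measurableC.
  - by apply: measurableC; exact: measurable_small_score.
  by rewrite EFinD; apply: leeD; [exact: PE|exact: tau_prob].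
rewrite mulrC EFinM; apply: lee_wpmul2l; first by rewrite lee_fin invr_ge0 ltW.
exact: integral_mass_bound_le.
Qed.

End FixedSampleSize.

(** * Sums over model sizes *)

Section ModelSizes.
Context {R : realType}.

Lemma bin_le_expn n m : ('C(n, m) <= n ^ m)%N.
Proof.
apply: (@leq_trans (n ^_ m)).
  by rewrite -bin_ffact leq_pmulr // fact_gt0.
elim: m => [|m ih] //.
by rewrite ffactnSr expnSr leq_mul // leq_subr.
Qed.

Lemma sum_over_model_sizes (p smax : nat) (w g : nat -> R) (Q : pred nat) :
  (smax <= p)%N ->
  \sum_(S : {set 'I_p} | (#|S| <= smax)%N && Q #|S|) model_prior w S * g #|S|
    = \sum_(s < smax.+1 | Q s) w s * g s.
Proof.
move=> sp; rewrite (partition_big (fun S : {set 'I_p} => inord #|S|)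
  (fun s : 'I_smax.+1 => Q s)) /=; last first.
  by move=> S /andP[h1 h2]; rewrite inordK.
apply: eq_bigr => s Qs.
transitivity (\sum_(S in [set S : {set 'I_p} | #|S| == s]%SET) w s / 'C(p, s)%:R * g s).
  apply: eq_big => [S|S].
    rewrite inE; have [h|h] := leqP #|S| smax; last first.
      by apply/esym/negbTE; rewrite neq_ltn (leq_trans _ h) ?orbT // ltn_ord.
    rewrite -val_eqE /= inordK //.
    by case: eqP => [->|]; rewrite ?Qs // andbF.
  move=> /andP[/andP[h _] /eqP <-].
  by rewrite /model_prior inordK.
rewrite sumr_const.
rewrite card_draws card_ord -[_ *+ _]mulr_natr.
have c0 : 'C(p, s)%:R != 0 :> R.
  by rewrite pnatr_eq0 -lt0n bin_gt0 (leq_trans _ sp) // -ltnS.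
by rewrite mulrAC -mulrA; field.
Qed.

Variables (p s0 smax : nat) (w : nat -> R) (L A2 A4 A5 lambda D kap K : R).
Hypothesis pE : p%:R = expR L.
Hypothesis p_ge2 : 2 <= expR L.
Hypothesis s0_gt0 : (0 < s0)%N.
Hypothesis s0_smax : (s0 <= smax)%N.
Hypothesis smax_p : (smax <= p)%N.
Hypothesis w_decay : forall s, (1 <= s <= smax)%N ->
  w s <= A2 * expR (- A4 * L) * w s.-1.
Hypothesis w0_gt0 : 0 < w s0.
Hypothesis A2_gt0 : 0 < A2.
Hypothesis A4_gt0 : 0 < A4.
Hypothesis A5_gt0 : 0 < A5.
Hypothesis D_gt0 : 0 < D.
Hypothesis A2_small : A2 <= expR (A4 / 8 * L).
Hypothesis D_small : Num.sqrt 2 * D <= expR (A4 / 8 * L).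
Hypothesis lambda_le : lambda <= A4.
Hypothesis lambda_ge : expR (- A5 * L) <= lambda.
Hypothesis kap_gt0 : 0 < kap.
Hypothesis kap_le : kap <= expR (2 * L).
Hypothesis K_ge : 6 + A4 + A5 <= A4 / 4 * (K - 1).

Let L_gt0 : 0 < L.
Proof. by rewrite -ltr_expR expR0 (lt_le_trans _ p_ge2) // ltr1n. Qed.

Let h : R := expR (lambda * L / 2) * (Num.sqrt 2 * D).

Let hX s : h ^+ s = expR (lambda * s%:R * L / 2) * (Num.sqrt 2 * D) ^+ s.
Proof. by rewrite /h exprMn -expRM_natr; congr (expR _ * _); ring. Qed.

Let h_ge0 : 0 <= h.
Proof. by rewrite mulr_ge0 ?expR_ge0 // mulr_ge0 ?sqrtr_ge0 // ltW. Qed.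

Let h_le : h <= expR (5 * A4 / 8 * L).
Proof.
rewrite (_ : 5 * A4 / 8 * L = A4 * L / 2 + A4 / 8 * L); last by field.
rewrite expRD; apply: ler_pM => //; first by rewrite mulr_ge0 ?sqrtr_ge0 // ltW.
by rewrite ler_expR ler_pM2r // ler_pM2r.
Qed.

Let a : R := A2 * expR (- A4 * L).

Let a_ge0 : 0 <= a. Proof. by rewrite mulr_ge0 ?expR_ge0 // ltW. Qed.

Let ah_le : a * h <= expR (- (A4 / 4) * L).
Proof.
rewrite (_ : - (A4 / 4) * L = (A4 / 8 * L + - A4 * L) + 5 * A4 / 8 * L); last by field.
rewrite !expRD; apply: ler_pM => //.
by rewrite ler_wpM2r ?expR_ge0.
Qed.

Let w_geometric m : (s0 + m <= smax)%N -> w (s0 + m) <= a ^+ m * w s0.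
Proof.
elim: m => [|m ih] hm; first by rewrite addn0 expr0 mul1r.
have hm' : (s0 + m <= smax)%N by rewrite (leq_trans _ hm) // leq_add2l.
rewrite exprS -mulrA addnS.
apply: (@le_trans _ _ (a * w (s0 + m))).
  by apply: (w_decay (s := (s0 + m).+1)); rewrite -addnS hm andbT addnS.
by rewrite ler_wpM2l // ih.
Qed.

(** From [s0] on, each further variable multiplies the weight by at most [a] and the
    price of the slab by [h], hence the product by a negative power of the dimension,
    while the [s0] variables before that cost a fixed power each. *)
Let term_le (s : 'I_smax.+1) : K * s0%:R < s%:R :> R ->
  w s * h ^+ s <= w s0 * expR (- (6 + 3 * A4 / 8 + A5) * L * s0%:R).
Proof.
move=> Ks; have s0R : 0 < s0%:R :> R by rewrite ltr0n.
have K1 : 1 <= K.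
  have : 0 <= A4 / 4 * (K - 1) by apply: le_trans K_ge; rewrite !addr_ge0 // ltW.
  by rewrite pmulr_rge0 ?subr_ge0 // divr_gt0.
have s0s : (s0 <= s)%N.
  by rewrite -(ler_nat R) (le_trans _ (ltW Ks)) // ler_peMl // ltW.
have [m sE] : exists m, s = (s0 + m)%N :> nat by exists (s - s0)%N; rewrite subnKC.
have mge : (K - 1) * s0%:R <= m%:R :> R.
  by move: Ks; rewrite sE natrD mulrBl mul1r; lra.
have hm : (s0 + m <= smax)%N by rewrite -sE -ltnS.
rewrite sE.
apply: (@le_trans _ _ (w s0 * (h ^+ s0 * (a * h) ^+ m))).
  rewrite exprD (_ : w s0 * _ = a ^+ m * w s0 * (h ^+ s0 * h ^+ m)); last first.
    by rewrite (exprMn m a h); ring.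
  apply: ler_wpM2r; last exact: w_geometric.
  by rewrite mulr_ge0 // exprn_ge0.
rewrite ler_wpM2l ?(ltW w0_gt0) //.
have hs : h ^+ s0 <= expR (5 * A4 / 8 * L * s0%:R).
  by rewrite expRM_natr lerXn2r ?nnegrE ?expR_ge0.
have ahm : (a * h) ^+ m <= expR (- (A4 / 4) * L * m%:R).
  rewrite expRM_natr; apply: lerXn2r; rewrite ?nnegrE ?expR_ge0 //.
  exact: mulr_ge0.
apply: le_trans (ler_pM (exprn_ge0 _ h_ge0) (exprn_ge0 _ (mulr_ge0 a_ge0 h_ge0)) hs ahm) _.
rewrite -expRD ler_expR.
have Lm : A4 / 4 * L * ((K - 1) * s0%:R) <= A4 / 4 * L * m%:R.
  by rewrite ler_wpM2l // mulr_ge0 ?divr_ge0 // ltW.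
have Ls : 0 < L * s0%:R by rewrite mulr_gt0.
have KL : (6 + A4 + A5) * (L * s0%:R) <= A4 / 4 * (K - 1) * (L * s0%:R).
  by rewrite ler_pM2r.
rewrite -subr_ge0.
rewrite (_ : _ - _ = (A4 / 4 * L * m%:R - A4 / 4 * L * ((K - 1) * s0%:R))
  + (A4 / 4 * (K - 1) * (L * s0%:R) - (6 + A4 + A5) * (L * s0%:R))); last by field.
by rewrite addr_ge0 ?subr_ge0.
Qed.

(** In the evidence, p^(s0) pays for the number of models of size [s0] and a further
    fixed power of p to the s0 for the volume of the ellipsoid; [K] is chosen so that
    the geometric decay of the prior outweighs everything by one more factor p^(s0). *)
Lemma mass_over_evidence_le :
  (\sum_(s < smax.+1 | K * s0%:R < s%:R)
     w s * (expR (lambda * s%:R * L / 2) * (Num.sqrt 2 * D) ^+ s))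
  / (w s0 / 'C(p, s0)%:R * (Num.sqrt (lambda / kap) ^+ s0 / 2))
  <= p%:R ^- s0.
Proof.
have l0 : 0 < lambda by apply: lt_le_trans lambda_ge; exact: expR_gt0.
have s0R : 1 <= s0%:R :> R by rewrite ler1n.
have binR : 0 < 'C(p, s0)%:R :> R by rewrite ltr0n bin_gt0 (leq_trans s0_smax).
pose B := expR (- (6 + 3 * A4 / 8 + A5) * L * s0%:R).
have num : \sum_(s < smax.+1 | K * s0%:R < s%:R)
     w s * (expR (lambda * s%:R * L / 2) * (Num.sqrt 2 * D) ^+ s)
   <= w s0 * (expR (2 * L * s0%:R) * B).
  apply: (@le_trans _ _ (\sum_(s < smax.+1) w s0 * B)).
    rewrite big_mkcond; apply: ler_sum => s _; case: ifP => [Ks|_]; last first.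
      by rewrite mulr_ge0 ?expR_ge0 // ltW.
    by apply: le_trans (term_le Ks); rewrite hX.
  rewrite sumr_const card_ord -[leLHS]mulr_natr -mulrA.
  apply: ler_wpM2l; first exact: ltW.
  rewrite mulrC; apply: ler_wpM2r; first exact: expR_ge0.
  apply: (@le_trans _ _ (expR (2 * L))); last first.
    by rewrite ler_expR ler_peMr // mulr_ge0 // ltW.
  rewrite -natr1; apply: (@le_trans _ _ (expR L + expR L)).
    by apply: lerD; [rewrite -pE ler_nat|move: p_ge2; lra].
  have -> : expR (2 * L) = expR L * expR L by rewrite mulr_natl mulr2n expRD.
  by move: p_ge2; move: (expR L) => e e2; rewrite -mulr2n -[leLHS]mulr_natl ler_wpM2r //; lra.
have den : w s0 * expR (- (2 + (A5 + 2) / 2) * L * s0%:R)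
   <= w s0 / 'C(p, s0)%:R * (Num.sqrt (lambda / kap) ^+ s0 / 2).
  rewrite -[leRHS]mulrA; apply: ler_wpM2l; first exact: ltW.
  rewrite (_ : - (2 + _ / 2) * L * s0%:R = - (L * s0%:R) +
    (- ((A5 + 2) / 2) * L * s0%:R - L * s0%:R)); last by field.
  rewrite !expRD; apply: ler_pM; rewrite ?mulr_ge0 ?expR_ge0 //.
    rewrite expRN lef_pV2 ?posrE ?expR_gt0 // expRM_natr -pE -natrX ler_nat.
    exact: bin_le_expn.
  apply: ler_pM; rewrite ?expR_ge0 //.
    rewrite expRM_natr lerXn2r ?nnegrE ?expR_ge0 ?sqrtr_ge0 //.
    rewrite -[leLHS]ger0_norm ?expR_ge0 // -sqrtr_sqr ler_wsqrtr //.
    rewrite ler_pdivlMr // -expRM_natr.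
    apply: (@le_trans _ _ (expR (- ((A5 + 2) / 2) * L * 2) * expR (2 * L))).
      by rewrite ler_wpM2l // expR_ge0.
    rewrite -expRD; apply: le_trans lambda_ge; rewrite ler_expR.
    by rewrite le_eqVlt; apply/orP; left; apply/eqP; field.
  rewrite expRN lef_pV2 ?posrE ?expR_gt0 //.
  by apply: le_trans p_ge2 _; rewrite ler_expR ler_peMr // ltW.
have w_pos : 0 < w s0 * expR (- (2 + (A5 + 2) / 2) * L * s0%:R).
  by rewrite mulr_gt0 ?expR_gt0.
have den_pos := lt_le_trans w_pos den.
rewrite ler_pdivrMr //; apply: (le_trans num).
apply: (@le_trans _ _ (p%:R ^- s0 * (w s0 * expR (- (2 + (A5 + 2) / 2) * L * s0%:R)))).
  rewrite pE -expRM_natr -expRN [leRHS]mulrCA; apply: ler_wpM2l; first exact: ltW.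
  rewrite -!expRD ler_expR.
  have Ls : 0 <= L * s0%:R by rewrite mulr_ge0 // ltW.
  have A4L : 0 <= A4 * (L * s0%:R) by rewrite mulr_ge0 // ltW.
  have A5L : 0 <= A5 * (L * s0%:R) by rewrite mulr_ge0 // ltW.
  lra.
by rewrite ler_wpM2l // invr_ge0 exprn_ge0.
Qed.

End ModelSizes.

(** * Eventual conditions *)

Section Eventually.
Context {R : realType}.

(** Two-sided geometric control makes the weights vanish together. *)
Lemma prior_weight_gt0 (smax s0 : nat) (w : nat -> R) (c1 c2 : R) :
  0 < c1 -> (s0 <= smax)%N ->
  (forall s, (s <= smax)%N -> 0 <= w s) ->
  \sum_(0 <= s < smax.+1) w s = 1 ->
  (forall s, (1 <= s <= smax)%N -> c1 * w s.-1 <= w s <= c2 * w s.-1) ->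
  0 < w s0.
Proof.
move=> c10 s0m w0 wsum wd; rewrite lt_def w0 // andbT; apply/eqP => ws0.
have step s : (s < smax)%N -> (w s == 0) = (w s.+1 == 0).
  move=> hs; have /andP[h1 h2] : c1 * w s <= w s.+1 <= c2 * w s by exact: (wd s.+1).
  have ws := w0 s (ltnW hs); have ws' := w0 s.+1 hs.
  apply/eqP/eqP => h.
    by apply/eqP; rewrite eq_le ws' andbT; move: h2; rewrite h mulr0.
  apply/eqP; rewrite eq_le ws andbT; move: h1; rewrite h.
  by rewrite pmulr_rle0.
have all0 s : (s <= smax)%N -> (w s == 0) = (w 0%N == 0).
  by elim: s => [//|s ih] hs; rewrite -step // ih // ltnW.
have w00 : w 0%N == 0 by rewrite -(all0 s0) // ws0.
move: wsum; rewrite big_nat big1 => [/eqP|s /andP[_ hs]].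
  by rewrite eq_sym oner_eq0.
by apply/eqP; rewrite all0 // -ltnS.
Qed.

Lemma ln_dimension_large (p : nat -> nat) (c : R) : 0 < c ->
  (\forall n \near \oo, n%:R `^ c <= (p n)%:R) ->
  forall M : R, \forall n \near \oo, (0 < (p n)%:R :> R) /\ M <= ln ((p n)%:R : R).
Proof.
move=> c0 p_ge M; near=> n.
have h1 : n%:R `^ c <= (p n)%:R by near: n.
have h2 : (expR M) `^ c^-1 <= n%:R by near: n; exact: nbhs_infty_ger.
have : expR M <= (p n)%:R.
  apply: le_trans h1.
  have -> : expR M = ((expR M) `^ c^-1) `^ c.
    by rewrite -powRrM mulVf ?gt_eqF // powRr1 ?expR_ge0.
  by apply: (ge0_ler_powR (ltW c0)); rewrite ?nnegrE ?powR_ge0 ?ler0n.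
move=> h; have p0 : 0 < (p n)%:R :> R by apply: lt_le_trans h; exact: expR_gt0.
by split=> //; rewrite -[M]expRK ler_ln ?posrE ?expR_gt0.
Unshelve. all: by end_near. Qed.

End Eventually.

(** * Dimension of the fractional posterior *)

(** Only here are the level [tau] of the score event and the radius [r] of the
    ellipsoid around the truth chosen: tau ^ 2 = 6 Cdev log p makes the score event
    likely, [r] exceeds what [mle_localized] needs by a constant factor, and the bound
    on [zeta] is exactly what makes zeta * r <= 1/2. *)
Lemma posterior_mean_le_fixed (R : realType)
  (nu : {sigma_finite_measure set R -> \bar R}) (b k : R -> R) (Cdev : R)
  (k_meas : measurable_fun setT k)
  (b_conv : strictly_convex b)
  (b_diff : forall (j : nat) (x : R), (j < 3)%N -> derivable (derive1n j b) x 1)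
  (family_density : forall eta : R,
     (\int[nu]_y (glm_density b k eta y)%:E)%E = 1%E)
  (Cdev_ge1 : 1 <= Cdev)
  (b_dev : forall x y : R, `|y| <= 2^-1 -> derive1n 2 b (x + y) <= Cdev * derive1n 2 b x)
  (n p : nat) (X : 'M[R]_(n, p)) (theta0 : 'cV[R]_p) (theta0n0 : theta0 != 0)
  (dsp : measure_display) (Omega : measurableType dsp) (P : probability Omega R)
  (Y : 'I_n -> {RV P >-> R}) (Y_indep : mutually_independent Y)
  (Y_law : forall i, has_glm_law nu b k (Y i) ((X *m theta0) i 0))
  (kY_int : forall i, P.-integrable setT (fun omega => (k (Y i omega))%:E))
  (smax : nat) (smax_bounds : (#|supp theta0| <= smax <= \rank X)%N)
  (w : nat -> R) (A1 A2 A3 A4 A5 lambda D K alpha : R)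
  (A1_gt0 : 0 < A1) (A2_gt0 : 0 < A2) (A4_gt0 : 0 < A4) (A5_gt0 : 0 < A5)
  (w0 : forall s, (s <= smax)%N -> 0 <= w s)
  (wsum : \sum_(0 <= s < smax.+1) w s = 1)
  (wd : forall s, (1 <= s <= smax)%N ->
     A1 * p%:R `^ (- A3) * w s.-1 <= w s <= A2 * p%:R `^ (- A4) * w s.-1)
  (l0 : 0 < lambda) (l_ge : p%:R `^ (- A5) <= lambda) (l_A4 : lambda <= A4)
  (thetabar : forall S : {set 'I_p}, 'cV[R]_#|S|)
  (D_gt' : Num.sqrt 2 < D)
  (tb_unit : forall S : {set 'I_p}, (#|S| <= smax)%N ->
     fisher b (cols X S) (thetabar S) \in unitmx)
  (Fstar : fisher_star b k X Y (supp theta0) \in unitmx)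
  (alpha01 : 0 < alpha < 1)
  (K_ge : 6 + A4 + A5 <= A4 / 4 * (K - 1))
  (p0 : 0 < p%:R :> R) (L1 : 1 <= ln (p%:R : R))
  (LA2 : ln A2 / (A4 / 8) <= ln p%:R)
  (Lsqrt2 : ln (Num.sqrt 2) / (A4 / 16) <= ln p%:R)
  (LC : Cdev + A4 + 8 <= ln p%:R)
  (LD : `|0 - ln D / ln p%:R| < A4 / 16)
  (Lzeta : `|0 - zeta b k X Y (supp theta0) ^+ 2 * #|supp theta0|%:R * ln p%:R|
     < (216 * Cdev ^+ 3)^-1)
  (good : exists E : set Omega,
     [/\ measurable E, ((1 - p%:R^-1)%:E <= P E)%E &
      forall omega, E omega ->
        mle_regular b k X smax D (ln p%:R) thetabar (fun i => Y i omega)]) :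
  ('E_P[fun omega => posterior b k X smax w lambda alpha (fun i => Y i omega)
     [set theta | K * #|supp theta0|%:R < #|supp theta|%:R]%R]
   <= ((#|supp theta0|%:R * ln p%:R)^-1 + 2 * p%:R^-1 + p%:R ^- #|supp theta0|)%R%:E)%E.
Proof.
have [E [mE PE regE]] := good; have /andP[s0_smax smax_rank] := smax_bounds.
have C0 : 0 < Cdev by exact: lt_le_trans Cdev_ge1.
move: LA2 Lsqrt2 LC LD Lzeta L1 regE.
set s0 := #|supp theta0| in s0_smax *; set L := ln (p%:R : R).
move=> LA2 Lsqrt2 LC LD Lzeta L1 regE.
have pE : p%:R = expR L by rewrite /L lnK // posrE.
have L0 : 0 < L by exact: lt_le_trans L1.
have powE y : p%:R `^ y = expR (y * L) by rewrite /powR gt_eqF.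
have p_ge2 : 2 <= expR L by have := expR_ge1Dx L; move: L1; clear; lra.
have s0_gt0 : (0 < s0)%N.
  move: theta0n0; apply: contraNT; rewrite -leqNgt leqn0 cards_eq0 => /eqP h.
  apply/eqP/colP => j; rewrite mxE; apply/eqP.
  have : j \notin supp theta0 by rewrite h finset.in_set0.
  by rewrite inE negbK.
have smax_p : (smax <= p)%N by exact: leq_trans smax_rank (rank_leq_col _).
have w_s0 : 0 < w s0.
  by apply: prior_weight_gt0 s0_smax w0 wsum wd; rewrite mulr_gt0 ?powR_gt0.
have w_decay' s : (1 <= s <= smax)%N -> w s <= A2 * expR (- A4 * L) * w s.-1.
  by move=> /wd /andP[_]; rewrite powE.
rewrite powE in l_ge.
have D0 : 0 < D by apply: le_lt_trans D_gt'; exact: sqrtr_ge0.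
have A2_small : A2 <= expR (A4 / 8 * L).
  move: LA2; rewrite ler_pdivrMr ?divr_gt0 // mulrC => h.
  by rewrite -[leLHS]lnK ?posrE // ler_expR.
have D_small : Num.sqrt 2 * D <= expR (A4 / 8 * L).
  have s20 : 0 < Num.sqrt 2 :> R by rewrite sqrtr_gt0.
  move: Lsqrt2; rewrite ler_pdivrMr ?divr_gt0 // => h1.
  move: LD; rewrite sub0r normrN => h2.
  have := le_lt_trans (ler_norm _) h2; rewrite ltr_pdivrMr // => h3.
  rewrite -[Num.sqrt 2]lnK ?posrE // -[D]lnK ?posrE // -expRD ler_expR.
  move: h1 h3; clear; lra.
have kap_le : Cdev + lambda + 4 * (s0%:R + 1) <= expR (2 * L).
  have h : Cdev + A4 + 8 <= expR L.
    by have := expR_ge1Dx L; move: LC; clear; lra.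
  have s0p : s0%:R <= expR L by rewrite -pE ler_nat (leq_trans s0_smax).
  have -> : expR (2 * L) = expR L * expR L by rewrite mulr_natl mulr2n expRD.
  move: (expR L) h s0p p_ge2 Cdev_ge1 l_A4 A4_gt0; clear => x h s0p x2 *; nra.
have kap0 : 0 < Cdev + lambda + 4 * (s0%:R + 1).
  by rewrite !addr_gt0 // mulr_gt0 // ltr_wpDl.
have ratio := mass_over_evidence_le pE p_ge2 s0_gt0 s0_smax smax_p w_decay' w_s0
  A2_gt0 A4_gt0 A5_gt0 D0 A2_small D_small l_A4 l_ge kap0 kap_le K_ge.
(* [sg] is the Chernoff exponent, chosen to make each tail p^(-3) *)
pose sg := Num.sqrt (6 * L / Cdev).
have sg2 : sg ^+ 2 = 6 * L / Cdev.
  by rewrite sqr_sqrtr // divr_ge0 ?(ltW C0) // mulr_ge0 // ltW.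
have sg0 : 0 < sg by rewrite sqrtr_gt0 divr_gt0 // mulr_gt0.
pose tau := Cdev * sg; pose r := 3 * Cdev * (Num.sqrt s0%:R * tau).
have s0R : 1 <= s0%:R :> R by rewrite ler1n.
have ss0 : 1 <= Num.sqrt s0%:R :> R by rewrite -[leLHS]sqrtr1 ler_wsqrtr.
have tau0 : 0 < tau by rewrite mulr_gt0.
have st0 : 0 < Num.sqrt s0%:R * tau by rewrite mulr_gt0 // (lt_le_trans ltr01 ss0).
have r0 : 0 < r by rewrite /r mulr_gt0 // mulr_gt0.
have r_tau : 2 * Cdev * (Num.sqrt s0%:R * tau) < r.
  by rewrite /r ltr_pM2r // ltr_pM2r // ltr_nat.
have r2 : r ^+ 2 = 54 * Cdev ^+ 3 * (s0%:R * L).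
  rewrite /r /tau !exprMn sg2 sqr_sqrtr ?ler0n //.
  by field; rewrite gt_eqF.
have sL1 : 1 <= s0%:R * L by rewrite -[leLHS]mul1r ler_pM.
have Cdev_r : Cdev <= r ^+ 2.
  rewrite r2 -[leLHS]mulr1; apply: ler_pM => //; first exact: ltW.
  rewrite exprS mulrCA -[leLHS]mulr1 ler_wpM2l ?(ltW C0) //.
  have : 1 <= Cdev ^+ 2 by exact: exprn_ege1.
  clear; lra.
set z := zeta b k X Y (supp theta0).
have z0 : 0 <= z by exact: zeta_ge0.
have zr : z * r <= 2^-1.
  have zr0 : 0 <= z * r := mulr_ge0 z0 (ltW r0).
  rewrite -(ler_pXn2r (n := 2)) ?nnegrE //.
  rewrite exprMn r2.
  move: Lzeta; rewrite sub0r normrN -/z => h; have := le_lt_trans (ler_norm _) h.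
  rewrite -[X in _ < X]div1r ltr_pdivlMr ?mulr_gt0 ?exprn_gt0 // => h'.
  have -> : z ^+ 2 * (54 * Cdev ^+ 3 * (s0%:R * L))
     = z ^+ 2 * s0%:R * L * (216 * Cdev ^+ 3) / 4 by field.
  have -> : (2^-1 : R) ^+ 2 = 1 / 4 by field.
  move: h'; clear; lra.
have sgz : sg * z <= 2^-1.
  apply: le_trans zr; rewrite mulrC ler_wpM2l // /r /tau.
  rewrite -[leLHS]mul1r !mulrA ler_pM2r //.
  have h1 : 1 <= 3 * Cdev by move: Cdev_ge1; clear; lra.
  by rewrite -[leLHS]mulr1 ler_pM // -[leLHS]mulr1 ler_pM.
have score_prob : (P (~` small_score b X theta0 Y tau)
    <= (p%:R^-1)%:E)%E.
  apply: le_trans (small_score_prob k_meas b_conv b_diff family_density Cdev_ge1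
    b_dev Y_indep Y_law kY_int Fstar (ltW sg0) sgz) _.
  rewrite lee_fin sg2 (_ : Cdev * _ / 2 = L + (L + L)); last by field; rewrite gt_eqF.
  rewrite !opprD !expRD expRN -pE mulrCA.
  have s0p : s0%:R <= p%:R :> R by rewrite ler_nat (leq_trans s0_smax).
  move: p0 p_ge2 s0p; rewrite -pE -/s0 !mulrA; clear.
  move: (p%:R) => x x0 x2 s0x.
  have -> : 2 * s0%:R / x / x / x = (2 / x) * (s0%:R / x) / x.
    by field; rewrite gt_eqF.
  rewrite -[leRHS]mul1r ler_pM2r ?invr_gt0 // -[leRHS]mulr1 ler_pM //.
  - by rewrite divr_ge0 // ltW.
  - by rewrite divr_ge0 // ltW.
  - by rewrite ler_pdivrMr // mul1r.
  - by rewrite ler_pdivrMr // mul1r.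
have main := posterior_mean_le k_meas b_conv b_diff family_density Cdev_ge1 b_dev
  Y_indep Y_law kY_int K w0 l0 alpha01 D0 tb_unit Fstar mE PE regE
  (ltW tau0) score_prob r0 r_tau zr Cdev_r s0_smax w_s0.
apply: (le_trans main); rewrite lee_fin.
have mass : mass_bound_mean theta0 smax w lambda D L K
      / evidence_bound Cdev theta0 w lambda <= p%:R ^- s0.
  apply: le_trans ratio; rewrite le_eqVlt; apply/orP; left; apply/eqP; congr (_ / _).
  exact: (sum_over_model_sizes w
    (fun s => expR (lambda * s%:R * L / 2) * (Num.sqrt 2 * D) ^+ s)
    (fun s => K * s0%:R < s%:R) smax_p).
have sL0 : 0 <= (s0%:R * L)^-1 by rewrite invr_ge0 mulr_ge0 // ltW.
have aux (m1 m2 m3 m4 : R) : m1 <= m3 -> 0 <= m4 -> m2 + m2 + m1 <= m4 + 2 * m2 + m3.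
  by clear; lra.
exact: aux mass sL0.
Qed.

Theorem theorem4p2 (R : realType)
  (* the exponential family *)
  (nu : {sigma_finite_measure set R -> \bar R}) (b k : R -> R) (Cdev : R)
  (k_meas : measurable_fun setT k)
  (b_conv : strictly_convex b)
  (b_diff : forall (j : nat) (x : R), (j < 3)%N -> derivable (derive1n j b) x 1)
  (family_density : forall eta : R,
     (\int[nu]_y (glm_density b k eta y)%:E)%E = 1%E)
  (Cdev_ge1 : 1 <= Cdev)
  (b_dev : forall x y : R, `|y| <= 2^-1 -> derive1n 2 b (x + y) <= Cdev * derive1n 2 b x)
  (* design, true parameter, data *)
  (p : nat -> nat) (c : R) (c_gt0 : 0 < c)
  (p_ge : \forall n \near \oo, n%:R `^ c <= (p n)%:R)
  (X : forall n, 'M[R]_(n, p n))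
  (theta0 : forall n, 'cV[R]_(p n))
  (theta0_neq0 : \forall n \near \oo, theta0 n != 0)
  (dsp : nat -> measure_display) (Omega : forall n, measurableType (dsp n))
  (P : forall n, probability (Omega n) R)
  (Y : forall n, 'I_n -> {RV (P n) >-> R})
  (Y_indep : forall n, mutually_independent (Y n))
  (Y_law : forall n (i : 'I_n) (B : set R), measurable B ->
     P n (Y n i @^-1` B)
     = (\int[nu]_(y in B) (glm_density b k ((X n *m theta0 n) i 0) y)%:E)%E)
  (kY_int : forall n (i : 'I_n),
     (P n).-integrable setT (fun omega => (k (Y n i omega))%:E))
  (* prior *)
  (smax : nat -> nat)
  (smax_bounds : \forall n \near \oo,
     (#|supp (theta0 n)| <= smax n <= \rank (X n))%N)
  (w : nat -> nat -> R) (A1 A2 A3 A4 : R)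
  (A1_gt0 : 0 < A1) (A2_gt0 : 0 < A2) (A3_gt0 : 0 < A3) (A4_gt0 : 0 < A4)
  (w_ge0 : \forall n \near \oo, forall s, (s <= smax n)%N -> 0 <= w n s)
  (w_sum : \forall n \near \oo, \sum_(0 <= s < (smax n).+1) w n s = 1)
  (w_decay : \forall n \near \oo, forall s, (1 <= s <= smax n)%N ->
     A1 * (p n)%:R `^ (- A3) * w n s.-1 <= w n s
     <= A2 * (p n)%:R `^ (- A4) * w n s.-1)
  (lambda : nat -> R) (lambda_gt0 : \forall n \near \oo, 0 < lambda n)
  (* maximum likelihood estimators; Fisher information of the true model *)
  (D : nat -> R) (thetabar : forall n (S : {set 'I_(p n)}), 'cV[R]_#|S|)
  (D_gt : \forall n \near \oo, Num.sqrt 2 < D n)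
  (thetabar_nonsing : \forall n \near \oo, forall S : {set 'I_(p n)},
     (#|S| <= smax n)%N ->
     fisher b (cols (X n) S) (thetabar n S) \in unitmx)
  (mle_good : \forall n \near \oo, exists E : set (Omega n),
     [/\ measurable E, ((1 - (p n)%:R^-1)%:E <= P n E)%E &
      forall omega, E omega -> forall S : {set 'I_(p n)}, (#|S| <= smax n)%N ->
        let Z := cols (X n) S in
        let y := fun i => Y n i omega in
        let Fhat := fisher b Z (mle b k Z y) in
        let Fbar := fisher b Z (thetabar n S) in
        [/\ is_mle b k Z y (mle b k Z y),
            loewner_le ((D n)^-1 *: Fbar) Fhat,
            loewner_le Fhat (D n *: Fbar) &
            l2norm (sqrtmx Fbar *m (mle b k Z y - thetabar n S)) ^+ 2
              <= D n * #|S|%:R * ln (p n)%:R]])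
  (fisher_star_nonsing : \forall n \near \oo,
     fisher_star b k (X n) (Y n) (supp (theta0 n)) \in unitmx)
  (zeta_small :
     (fun n => zeta b k (X n) (Y n) (supp (theta0 n)) ^+ 2
               * #|supp (theta0 n)|%:R * ln (p n)%:R)
     @ \oo --> (0 : R))
  (* growth conditions *)
  (log_size :
     (fun n : nat =>
        ln (Num.max (\big[Num.max/0]_(i < n) derive1n 2 b ((X n *m theta0 n) i 0))
           (Num.max (row_sum_norm (cols (X n) (supp (theta0 n))))
           (Num.max
             ((min_eigenvalue (fisher_star b k (X n) (Y n) (supp (theta0 n))))^-1)%R
             (max_eigenvalue (fisher_star b k (X n) (Y n) (supp (theta0 n))))))) : R^o)
     =O_\oo (fun n : nat => ln (p n)%:R : R^o))
  (s0_small :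
     (fun n : nat => #|supp (theta0 n)|%:R * ln (p n)%:R : R^o)
     =o_\oo (fun n : nat => n%:R : R^o))
  (A5 A6 A7 : R) (A5_gt0 : 0 < A5) (A6_gt0 : 0 < A6) (A7_ge0 : 0 <= A7)
  (lambda_bounds : \forall n \near \oo,
     (p n)%:R `^ (- A5) <= lambda n <= A6 * (p n)%:R `^ (- A7))
  (alpha : R) (alpha01 : 0 < alpha < 1)
  (A6_lt_A4 : \forall n \near \oo, A6 * (p n)%:R `^ (- A7) < A4)
  (log_D : (fun n => ln (D n) / ln (p n)%:R) @ \oo --> (0 : R)) :
  exists2 Kdim : R, 1 < Kdim &
    \forall n \near \oo,
      ('E_(P n)[fun omega =>
         posterior b k (X n) (smax n) (w n) (lambda n) alpha
           (fun i => Y n i omega)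
           [set theta | Kdim * #|supp (theta0 n)|%:R < #|supp theta|%:R]%R]
       <= ((#|supp (theta0 n)|%:R * ln (p n)%:R)^-1 + 2 * (p n)%:R^-1
           + (p n)%:R ^- #|supp (theta0 n)|)%R%:E)%E.
Proof.
(* a unit of model size loses a factor p^(- A4 / 4) at least, once prior, slab and the
   constants are balanced; (K - 1) s0 of them have to pay for p^((6 + A4 + A5) s0) *)
pose K := 1 + 4 / A4 * (6 + A4 + A5).
have K_ge : 6 + A4 + A5 <= A4 / 4 * (K - 1).
  rewrite /K (_ : A4 / 4 * _ = 6 + A4 + A5) //.
  by field; rewrite gt_eqF.
exists K.
  by rewrite /K ltrDl mulr_gt0 ?divr_gt0 // !addr_gt0.
have C0 : 0 < Cdev by exact: lt_le_trans Cdev_ge1.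
have Llarge := ln_dimension_large c_gt0 p_ge.
have D_small : \forall n \near \oo, `|0 - ln (D n) / ln (p n)%:R| < A4 / 16.
  by move/cvgrPdist_lt: log_D; apply; exact: divr_gt0.
have zeta_small' : \forall n \near \oo,
    `|0 - zeta b k (X n) (Y n) (supp (theta0 n)) ^+ 2
      * #|supp (theta0 n)|%:R * ln (p n)%:R| < (216 * Cdev ^+ 3)^-1.
  move/cvgrPdist_lt: zeta_small; apply.
  by rewrite invr_gt0 mulr_gt0 ?exprn_gt0.
apply: filterS (filterI (filterI (filterI (Llarge 1) (Llarge (ln A2 / (A4 / 8))))
    (filterI (Llarge (ln (Num.sqrt 2) / (A4 / 16))) (Llarge (Cdev + A4 + 8))))
  (filterI (filterI (filterI D_small zeta_small') (filterI theta0_neq0 smax_bounds))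
    (filterI (filterI (filterI w_ge0 w_sum) (filterI w_decay lambda_gt0))
      (filterI (filterI (filterI lambda_bounds A6_lt_A4) (filterI D_gt fisher_star_nonsing))
        (filterI thetabar_nonsing mle_good))))).
move=> n [[[[p0 L1] [_ LA2]] [[_ Ls2] [_ LC]]] [[[Ds zs] [t0 sb]]
  [[[w0 ws] [wd l0]] [[[/andP[l1 l2] A64] [Dg Fs]] [tb good]]]]].
have law i : has_glm_law nu b k (Y n i) ((X n *m theta0 n) i 0).
  by move=> B mB; exact: Y_law.
exact: (posterior_mean_le_fixed k_meas b_conv b_diff family_density Cdev_ge1 b_dev
  t0 (Y_indep n) law (kY_int n) sb A1_gt0 A2_gt0 A4_gt0 A5_gt0
  w0 ws wd l0 l1 (le_trans l2 (ltW A64)) Dg tb Fs alpha01 K_ge p0 L1 LA2 Ls2 LC Ds zs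
  good).
Qed.
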